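(* Let $N\ge3$ and let $\Omega\subset\mathbb{R}^N$ be an open set such that $|\Omega|=+\infty$. Let $1<p<\infty$, $r>N/2$, and let $f\in L^r(\Omega)$ be a function decaying to $0$ at infinity as $O(|x|^{-\alpha})$ with $\alpha>1+N/2$. Let $U_0$ be the optimal potential, i.e. the minimizer of $\mathcal{E}_f$ over the class $$\mathcal{V}_2=\left\{V\ge0\ :\ \int_\Omega V^{-p}\,dx\le1\right\}.$$ Then there exist a constant $\sigma_2>0$ and an exponent $\beta=\beta(p)>2$ such that for every $V\in\mathcal{V}_2$ we have $$\mathcal{E}_f(V)\ge\mathcal{E}_f(U_0)+\sigma_2\left\|\frac1V-\frac1{U_0}\right\|^\beta_{L^p(\Omega)}.$$ If $|\Omega|<+\infty$, the same result holds for every $f\in W^{-1,2}(\Omega)$ without any additional hypothesis.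
   Context: $W^{1,2}_0(\Omega)$ is the homogeneous Sobolev space, i.e. the closure of $C^\infty_0(\Omega)$ with respect to the norm $\|u\|_{W^{1,2}_0(\Omega)}=(\int_\Omega|\nabla u|^2\,dx)^{1/2}$; $W^{-1,2}(\Omega)$ is its dual and $\langle\cdot,\cdot\rangle$ is the duality pairing. $|\Omega|$ is the $N$-dimensional Lebesgue measure. Potentials are Borel measurable and may take the value $+\infty$, with $1/(+\infty)=0$. For a potential $V\ge0$ the energy is $$\mathcal{E}_f(V)=\min_{u\in W^{1,2}_0(\Omega)}\left[\frac12\int_\Omega|\nabla u|^2\,dx+\frac12\int_\Omega Vu^2\,dx-\langle f,u\rangle\right].$$ The optimal potential $U_0$ is given by $$U_0=\left(\int_\Omega|u_0|^{2p/(p+1)}\,dx\right)^{1/p}|u_0|^{-2/(p+1)},$$ where $u_0\in W^{1,2}_0(\Omega)\cap L^{2p/(p+1)}(\Omega)$ is the unique minimizer over $W^{1,2}_0(\Omega)$ of $$J_{p,f}(u)=\frac12\int_\Omega|\nabla u|^2\,dx+\frac12\left(\int_\Omega|u|^{2p/(p+1)}\,dx\right)^{(p+1)/p}-\langle f,u\rangle,$$ with $J_{p,f}(u)=+\infty$ if $u\notin L^{2p/(p+1)}(\Omega)$. The constant $\sigma_2$ does not depend on $V$.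
   Formalization: The function (or functional) f is assumed to be nonzero: for f = 0 every V in the class is a minimizer, the formula for U_0 is undefined because u_0 = 0, and the inequality fails. *)

(* Defs.v *)
From HB Require Import structures.
From mathcomp Require Import all_boot all_order all_algebra.
From mathcomp Require Import all_classical all_reals all_analysis.
From mathcomp Require Import measurable_realfun.

Set Implicit Arguments.
Unset Strict Implicit.
Unset Printing Implicit Defensive.

Import Order.TTheory GRing.Theory Num.Theory.
Import numFieldNormedType.Exports.

Local Open Scope classical_set_scope.
Local Open Scope ring_scope.

Section rV_measurable.
Context {R : realType} (n : nat).

Definition rV_coord (i : 'I_n) (x : 'rV[R]_n) : measurableTypeR R := x ord0 i.

Let rV_set0 : g_sigma_preimage rV_coord set0.
Proof. exact: sigma_algebra0. Qed.

Let rV_setC A : g_sigma_preimage rV_coord A -> g_sigma_preimage rV_coord (~` A).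
Proof. exact: sigma_algebraC. Qed.

Let rV_bigcup (F : _^nat) : (forall i, g_sigma_preimage rV_coord (F i)) ->
  g_sigma_preimage rV_coord (\bigcup_i (F i)).
Proof. exact: sigma_algebra_bigcup. Qed.

(* Generated by the coordinates, as the library does for tuples; this is the
   Borel sigma-algebra, see measurable_rV_borel. *)
HB.instance Definition _ := @isMeasurable.Build
  (measure_tuple_display default_measure_display)
  'rV[R]_n (g_sigma_preimage rV_coord) rV_set0 rV_setC rV_bigcup.

Lemma measurable_rV_coord (i : 'I_n) :
  measurable_fun [set: 'rV[R]_n] (rV_coord i).
Proof.
move=> _ Y mY; rewrite setTI; apply: sub_sigma_algebra => /=.
rewrite -bigcup_seq/=; exists i => /=; first by rewrite mem_index_enum.
by exists Y => //; rewrite setTI.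
Qed.

Lemma measurable_fun_rVP d (T : measurableType d) (f : T -> 'rV[R]_n) :
  measurable_fun [set: T] f <->
  forall i, measurable_fun [set: T] (rV_coord i \o f).
Proof.
split=> [mf i|mf].
  by apply: measurableT_comp => //; exact: measurable_rV_coord.
have : g_sigma_preimage (fun i => rV_coord i \o f) `<=` measurable.
  apply: smallest_sub; first exact: sigma_algebra_measurable.
  rewrite -bigcup_seq/= => A [i _ [B mB <-]]; exact: mf.
rewrite g_sigma_preimage_comp => prefS _ A mA.
by apply: prefS; exists A.
Qed.

Let cube (c : 'rV[R]_n) (r : R) := [set x : 'rV[R]_n |
  forall i, `|x ord0 i - c ord0 i| < r].

Let measurable_cube c r : measurable (cube c r).
Proof.
rewrite (_ : cube c r = \bigcap_(i in [set: 'I_n])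
    (rV_coord i @^-1` `]c ord0 i - r, c ord0 i + r[)).
  apply: fin_bigcap_measurable => [|i _]; first exact: finite_finset.
  rewrite -[X in measurable X]setTI.
  by apply: measurable_rV_coord => //; exact: measurable_itv.
apply/seteqP; split=> x /=.
  by move=> h i _; rewrite /= in_itv/= -ltr_distl; exact: h.
by move=> h i; have := h i I; rewrite /= in_itv/= -ltr_distl.
Qed.

Lemma open_measurable_rV (A : set 'rV[R]_n) : open A -> measurable A.
Proof.
move=> oA; pose cr (q : 'rV[rat]_n * rat) : 'rV[R]_n := map_mx ratr q.1.
pose F q := if `[< cube (cr q) (ratr q.2) `<=` A >] then cube (cr q) (ratr q.2)
            else set0.
rewrite (_ : A = \bigcup_q F q); last first.
  apply/seteqP; split=> [x Ax|x [q _]]; rewrite /F; last first.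
    by case: asboolP => // sA xc; exact: sA.
  have : nbhs x A by rewrite nbhsE /=; exists A.
  rewrite -nbhs_ballE /nbhs_ball /nbhs_ball_ => -[r r0 xrA].
  have [k kr] : exists k : rat, 0 < (ratr k : R) < r / 2.
    have /rat_in_itvoo[k] : (0 : R) < r / 2 by rewrite divr_gt0.
    by rewrite in_itv/= => ?; exists k.
  have /andP[k0 k2] := kr.
  have /choice[q qP] : forall i, exists q : rat, `|x ord0 i - ratr q| < ratr k.
    move=> i.
    have /rat_in_itvoo[q] : x ord0 i - ratr k < x ord0 i + ratr k.
      by rewrite ltrD2l gtrN.
    by rewrite in_itv/= => qk; exists q; rewrite distrC ltr_distl.
  exists (\row_i q i, k) => //=.
  have xc : cube (cr (\row_i q i, k)) (ratr k) x.
    by move=> i; rewrite /cr /= !mxE.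
  case: asboolP => // -[] y yc; apply: xrA; split=> // i j.
  rewrite ord1; have := xc j; have := yc j; rewrite /ball/= => yj xj.
  rewrite (le_lt_trans (ler_distD (cr (\row_i q i, k) ord0 j) _ _))//.
  rewrite (splitr r) ltrD// ?(lt_trans xj)// distrC (lt_trans yj)//.
apply: countable_bigcupT_measurable => [|q]; first exact: countableP.
by rewrite /F; case: ifP => // _; exact: measurable_cube.
Qed.

Lemma measurable_rV_borel :
  (measurable : set (set 'rV[R]_n)) = <<s open >>.
Proof.
rewrite eqEsubset; split; last first.
  apply: smallest_sub; first exact: sigma_algebra_measurable.
  exact: open_measurable_rV.
apply: smallest_sub; first exact: smallest_sigma_algebra.
rewrite -bigcup_seq/= => A [i _ [B mB <-]].
suff : (measurable : set (set (measurableTypeR R))) `<=`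
  image_set_system setT (rV_coord i) <<s open >>.
  by move=> /(_ _ mB); rewrite /image_set_system/=.
rewrite [X in X `<=` _]RGenOpens.measurableE.
apply: smallest_sub.
  by apply: sigma_algebra_image; exact: smallest_sigma_algebra.
move=> _ [a [b ->]]; rewrite /image_set_system/= setTI.
apply: sub_sigma_algebra; apply: open_comp; last exact: interval_open.
by move=> x _; exact: coord_continuous.
Qed.

End rV_measurable.

Section lebesgue_rV.
Context {R : realType}.

Definition rV_cons n (xv : measurableTypeR R * 'rV[R]_n) : 'rV[R]_n.+1 :=
  \row_i (if unlift ord0 i is Some j then xv.2 ord0 j else xv.1).

Definition rV_uncons n (x : 'rV[R]_n.+1) : measurableTypeR R * 'rV[R]_n :=
  (x ord0 ord0, \row_j x ord0 (lift ord0 j)).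

Lemma rV_consK n : cancel (@rV_cons n) (@rV_uncons n).
Proof.
move=> [x v]; rewrite /rV_uncons /rV_cons; congr pair.
  by rewrite mxE unlift_none.
by apply/rowP => j; rewrite !mxE liftK.
Qed.

Lemma measurable_rV_cons n :
  measurable_fun [set: measurableTypeR R * 'rV[R]_n] (@rV_cons n).
Proof.
apply/measurable_fun_rVP => i; case: (unliftP ord0 i) => [j ->|->].
  rewrite (_ : _ \o _ = rV_coord j \o snd); last first.
    by apply/funext => -[x v]/=; rewrite /rV_coord mxE liftK.
  by apply: measurableT_comp => //; exact: measurable_rV_coord.
rewrite (_ : _ \o _ = fst) //.
by apply/funext => -[x v]/=; rewrite /rV_coord mxE unlift_none.
Qed.

Lemma measurable_rV_uncons n : measurable_fun [set: 'rV[R]_n.+1] (@rV_uncons n).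
Proof.
apply/measurable_fun_pairP; split; first exact: (measurable_rV_coord ord0).
apply/measurable_fun_rVP => j.
rewrite (_ : _ \o _ = rV_coord (lift ord0 j)); first exact: measurable_rV_coord.
by apply/funext => x; rewrite /rV_coord /= mxE.
Qed.

Section step.
Variables (n : nat) (m : {sigma_finite_measure set 'rV[R]_n -> \bar R}).

Definition leb_step : set 'rV[R]_n.+1 -> \bar R :=
  pushforward (@lebesgue_measure R \x m)%E (@rV_cons n).

Let leb_step0 : leb_step set0 = 0%E.
Proof. by rewrite /leb_step /pushforward preimage_set0 measure0. Qed.

Let leb_step_ge0 A : (0 <= leb_step A)%E.
Proof. by rewrite /leb_step /pushforward measure_ge0. Qed.

Let leb_step_sigma_additive : semi_sigma_additive leb_step.
Proof.
move=> F mF tF mUF; rewrite /leb_step /pushforward preimage_bigcup.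
apply: measure_semi_sigma_additive.
- by move=> k; rewrite -[X in measurable X]setTI; exact: measurable_rV_cons.
- apply/trivIsetP => /= i j _ _ ij; rewrite -preimage_setI.
  by move/trivIsetP : tF => /(_ _ _ _ _ ij) ->//; rewrite preimage_set0.
- by rewrite -preimage_bigcup -[X in measurable X]setTI; exact: measurable_rV_cons.
Qed.

HB.instance Definition _ := isMeasure.Build _ _ _ leb_step
  leb_step0 leb_step_ge0 leb_step_sigma_additive.

Let leb_step_sigma_finite : sigma_finite setT leb_step.
Proof.
have /sigma_finiteP[F [TF ndF Foo]] := sigma_finiteT (@lebesgue_measure R).
have /sigma_finiteP[G [TG ndG Goo]] := sigma_finiteT m.
exists (fun k => @rV_uncons n @^-1` (F k `*` G k)).
  rewrite -preimage_bigcup [X in _ @^-1` X](_ : _ = setT) ?preimage_setT//.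
  rewrite -setXTT TF TG predeqE => -[x y]; split.
    by move=> [k _ []/= ? ?]; split; exists k.
  move=> [/= [k _ Fkx] [l _ Gly]]; exists (maxn k l) => //; split.
  - by move: x Fkx; exact/subsetPset/ndF/leq_maxl.
  - by move: y Gly; exact/subsetPset/ndG/leq_maxr.
move=> k; have [mF Fk] := Foo k; have [mG Gk] := Goo k; split.
  rewrite -[X in measurable X]setTI; apply: measurable_rV_uncons => //.
  exact: measurableX.
rewrite /leb_step /pushforward -comp_preimage (_ : _ \o _ = id); last first.
  by apply/funext => x /=; rewrite rV_consK.
by rewrite preimage_id product_measure1E// lte_mul_pinfty// ge0_fin_numE.
Qed.

HB.instance Definition _ := Measure_isSigmaFinite.Build _ _ _ leb_step
  leb_step_sigma_finite.

End step.

Fixpoint lebesgue_rV (n : nat) :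
    {sigma_finite_measure set 'rV[R]_n -> \bar R} :=
  if n is k.+1 return {sigma_finite_measure set 'rV[R]_n -> \bar R}
  then leb_step (lebesgue_rV k) else dirac (0 : 'rV[R]_0).

End lebesgue_rV.

Section sobolev.
Context {R : realType} {N : nat}.
Implicit Types (Omega : set 'rV[R]_N) (u v phi : 'rV[R]_N -> R)
  (g h : 'rV[R]_N -> 'rV[R]_N) (L : ('rV[R]_N -> R) -> R).

(* `|x| on 'rV[R]_N is the sup norm. *)
Definition enorm (x : 'rV[R]_N) : R := Num.sqrt (\sum_i x ord0 i ^+ 2).

Definition partial (i : 'I_N) phi : 'rV[R]_N -> R :=
  fun x => 'D_(delta_mx ord0 i) phi x.

Definition gradient phi : 'rV[R]_N -> 'rV[R]_N :=
  fun x => \row_i partial i phi x.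

(* C^infinity: all iterated partial derivatives exist and are (Frechet)
   differentiable everywhere. *)
Definition smooth phi := forall (s : seq 'I_N) (x : 'rV[R]_N),
  differentiable (foldr partial phi s) x.

(* C_0^infinity(Omega), extended by zero outside Omega. *)
Definition test_function Omega phi :=
  [/\ smooth phi,
      compact (closure [set x | phi x != 0]) &
      closure [set x | phi x != 0] `<=` Omega].

Definition dirichlet Omega g : \bar R :=
  (\int[lebesgue_rV N]_(x in Omega) (enorm (g x) ^+ 2)%:E)%E.

(* u is (a representative of) an element of W^{1,2}_0(Omega), with gradient g:
   test functions converge to u a.e. in Omega while their gradients converge to
   g in L^2(Omega).  When N >= 3 or Omega has finite measure, the Sobolev (resp.
   Poincare) inequality embeds the abstract completion of C_0^infinity(Omega)
   for the norm |grad phi|_2 in a space of functions; Cauchy sequences then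
   converge a.e. along a subsequence, the limit u determines g up to null sets,
   and this relation is exactly the realization of the completion.  Values
   outside Omega are irrelevant. *)
Definition W012 Omega u g :=
  [/\ measurable_fun Omega u, measurable_fun Omega g &
      exists phi_ : nat -> 'rV[R]_N -> R,
      [/\ forall n, test_function Omega (phi_ n),
          dirichlet Omega (fun x => gradient (phi_ n) x - g x)
            @[n --> \oo] --> 0%E &
          {ae lebesgue_rV N, forall x, Omega x ->
            phi_ n x @[n --> \oo] --> u x}]].

(* L is an element of W^{-1,2}(Omega), as a linear form on representatives;
   boundedness makes it constant on a.e. equality classes. *)
Definition dual_W012 Omega L :=
  (forall (a : R) u g v h, W012 Omega u g -> W012 Omega v h ->
     L (fun x => a * u x + v x) = a * L u + L v) /\
  (exists C : R, forall u g, W012 Omega u g ->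
     (`|L u|%:E <= C%:E * dirichlet Omega g `^ 2^-1)%E).

(* The duality pairing <f, u> when f is a function; meaningful when f * u is
   integrable over Omega for all u in W^{1,2}_0(Omega). *)
Definition pairing Omega (f : 'rV[R]_N -> R) : ('rV[R]_N -> R) -> R :=
  fun u => \int[lebesgue_rV N]_(x in Omega) (f x * u x).

Definition schroedinger Omega L (V : 'rV[R]_N -> \bar R) u g : \bar R :=
  ((2^-1)%:E * dirichlet Omega g
   + (2^-1)%:E * (\int[lebesgue_rV N]_(x in Omega) (V x * (u x ^+ 2)%:E))
   - (L u)%:E)%E.

(* The minimum, written as an infimum; it is attained by the direct method. The
   potential term may be +oo. *)
Definition energy Omega L (V : 'rV[R]_N -> \bar R) : \bar R :=
  ereal_inf [set e | exists u g,
    W012 Omega u g /\ e = schroedinger Omega L V u g].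

(* V^{-p} is read as (1/V)^p, with 1/0 = +oo and 1/(+oo) = 0; the library's
   0 `^ (- p) is 0 instead. *)
Definition class_V2 (p : R) Omega (V : 'rV[R]_N -> \bar R) :=
  [/\ measurable_fun Omega V,
      forall x, Omega x -> (0 <= V x)%E &
      (\int[lebesgue_rV N]_(x in Omega) ((V x)^-1 `^ p) <= 1)%E].

Definition int_pow (p : R) Omega u : \bar R :=
  (\int[lebesgue_rV N]_(x in Omega) (`|u x| `^ (2 * p / (p + 1)))%:E)%E.

(* J_{p,f}; it is +oo as soon as int_pow p Omega u is. *)
Definition J (p : R) Omega L u g : \bar R :=
  ((2^-1)%:E * dirichlet Omega g
   + (2^-1)%:E * int_pow p Omega u `^ ((p + 1) / p)
   - (L u)%:E)%E.

Definition J_minimizer (p : R) Omega L u0 :=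
  exists g0, [/\ W012 Omega u0 g0, (int_pow p Omega u0 < +oo)%E &
    forall u g, W012 Omega u g -> (J p Omega L u0 g0 <= J p Omega L u g)%E].

(* Equal to +oo where u0 vanishes. *)
Definition optimal_potential (p : R) Omega u0 : 'rV[R]_N -> \bar R :=
  fun x => (int_pow p Omega u0 `^ p^-1
            * ((`|u0 x| `^ (2 / (p + 1)))%:E)^-1)%E.

Definition inv_dist (p : R) Omega (V U : 'rV[R]_N -> \bar R) : \bar R :=
  ('N[lebesgue_rV N]_p%:E [ (fun x => (V x)^-1 - (U x)^-1) \_ Omega ])%E.

(* For f = 0 every admissible potential is optimal (all energies vanish and U_0
   is not defined), whence the non-triviality of L, as a distribution. *)
Definition energy_stability (p beta : R) Omega L :=
  (exists phi, test_function Omega phi /\ L phi <> 0) ->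
  forall u0, J_minimizer p Omega L u0 ->
  let U0 := optimal_potential p Omega u0 in
  [/\ class_V2 p Omega U0,
      forall V, class_V2 p Omega V -> (energy Omega L U0 <= energy Omega L V)%E &
      exists sigma2 : R, 0 < sigma2 /\
        forall V, class_V2 p Omega V ->
        (energy Omega L V >=
           energy Omega L U0 + sigma2%:E * inv_dist p Omega V U0 `^ beta)%E].

End sobolev.

(* Main.v *)
Require Import Defs.
From mathcomp Require Import all_boot all_order all_algebra.
From mathcomp Require Import all_classical all_reals all_analysis.
From mathcomp Require Import measurable_realfun.
From mathcomp Require Import ring lra.
Set Implicit Arguments.
Unset Strict Implicit.
Unset Printing Implicit Defensive.
Import Order.TTheory GRing.Theory Num.Theory.
Import numFieldNormedType.Exports.
Local Open Scope classical_set_scope.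
Local Open Scope ring_scope.

(** Put q = 2p/(p+1) and, for a potential V, write a = 1/V. Hoelder's inequality
    gives (int |u|^q)^((p+1)/p) <= (int a^p)^(1/p) * int V u^2, so on the class
    int a^p <= 1 the Schroedinger energy of any u is at least J u. For V = U_0
    and u = u_0 the two are equal: the pair (u_0, U_0) minimizes the
    Schroedinger energy jointly in (u, V), and the minimum is J u_0 < 0.

    The quantitative statement comes from comparing an arbitrary admissible pair
    (u, V) with (u_0, U_0) at their midpoint. Because (u, a) |-> u^2 / a is jointly convex, u' = (u + u_0)/2 and
    m = (a + a_0)/2 satisfy u'^2 <= m * (V u^2 + U_0 u_0^2) / 2 pointwise
    (sqr_midpoint_le). Hoelder then bounds J u' by the mean of the energies of
    (u, V) and (u_0, U_0) minus a multiple of 1 - int m^p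
    (integral_powR_mean_le, J_midpoint_le), whereas J u' >= J u_0 by minimality.
    So 1 - int m^p, the uniform convexity gap of the L^p norm between a and a_0,
    is at most a multiple of the energy gap.

    It remains to see that the gap 1 - int m^p controls a - a_0. Young's
    inequality with a Hellinger-type remainder (young_powR_sqr), applied to
    (a, m) and to (a_0, m), gives 1 - int m^p >= c * G with
    G = int (a^(p/2) - a_0^(p/2))^2 (powR_midpoint_gap). Finally
    |a - a_0|^p <= |a^p - a_0^p|, and the Cauchy-Schwarz inequality applied to
    the factorization of a^p - a_0^p as a difference of squares gives
    (int |a - a_0|^p)^2 <= 4 G (integral_powR_dist_sqr_le). Altogether the
    2p-th power of the L^p distance is at most a multiple of the energy gap:
    beta = 2p works, uniformly in the dimension and the domain.

    The comparison at the midpoint uses L u' = (L u + L u_0)/2, which is known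
    when L u and L u_0 are nonzero (linear_off_kernel). For the pairing with a
    function f this is so because the integral of f u is 0 by convention when
    f u is not integrable: a nonzero value forces integrability. If L u = 0, the
    energy of (u, V) is nonnegative, hence exceeds J u_0 by at least |J u_0|,
    while the distance is bounded. And L u_0 is nonzero since J u_0 < 0. *)

(** * Sharpened scalar convexity inequalities *)

Section scalar_inequalities.
Context {R : realType}.
Implicit Types a b p r s t x y theta : R.

Lemma young_powR theta x y : 0 <= theta <= 1 -> 0 <= x -> 0 <= y ->
  x `^ theta * y `^ (1 - theta) <= theta * x + (1 - theta) * y.
Proof.
move=> /andP[]; rewrite le_eqVlt => /predU1P[<- _|t0].
  by move=> x0 y0; rewrite powRr0 subr0 powRr1//; lra.
rewrite le_eqVlt => /predU1P[->|t1 x0 y0].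
  by move=> x0 y0; rewrite subrr powRr0 powRr1//; lra.
have t1' : 0 < 1 - theta by lra.
have := @conjugate_powR _ (x `^ theta) (y `^ (1 - theta)) theta^-1
  (1 - theta)^-1 (powR_ge0 _ _) (powR_ge0 _ _).
rewrite !invr_gt0 !invrK => /(_ t0 t1' (subrKC _ _))/le_trans; apply.
by rewrite -!powRrM !mulfV ?gt_eqF// !powRr1// mulrC (mulrC y).
Qed.

(** Since theta * s^2 + (1 - theta) * t^2 - theta * (s - t)^2 equals
    2 * theta * (s * t) + (1 - 2 * theta) * t^2, this is the plain inequality for
    s * t and t^2 with the doubled exponent 2 * theta. *)
Lemma young_powR_sqr_le r theta s t : 0 <= theta -> r <= theta -> theta <= 2^-1 ->
  0 <= s -> 0 <= t ->
  (s ^+ 2) `^ theta * (t ^+ 2) `^ (1 - theta) + r * (s - t) ^+ 2 <=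
  theta * s ^+ 2 + (1 - theta) * t ^+ 2.
Proof.
move=> th0 rth th2 s0 t0.
have st0 : 0 <= s * t by rewrite mulr_ge0.
have := @young_powR (2 * theta) (s * t) (t ^+ 2) _ st0 (sqr_ge0 _).
have -> : (s * t) `^ (2 * theta) * (t ^+ 2) `^ (1 - 2 * theta) =
   (s ^+ 2) `^ theta * (t ^+ 2) `^ (1 - theta).
  rewrite powRM// -!powR_mulrn// -!powRrM -mulrA; congr (_ * _).
  have [->|tn0] := eqVneq t 0.
    have [->|thn0] := eqVneq theta 0; first by rewrite !mulr0 subr0 powRr0 mul1r.
    rewrite (powR0 (mulf_neq0 _ thn0))// mul0r powR0//.
    by rewrite gt_eqF//; lra.
  by rewrite -powRD ?tn0 ?implybT//; congr (_ `^ _); ring.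
move=> h; have {h} := h _; have -> : 0 <= 2 * theta <= 1 by lra.
move=> /(_ isT) h.
have : r * (s - t) ^+ 2 <= theta * (s - t) ^+ 2 by rewrite ler_wpM2r// sqr_ge0.
nra.
Qed.

(** The remainder is the squared difference of the square roots s and t of the two
    numbers whose means are compared: it is quadratic in s and t for every
    exponent theta, and it can be integrated. *)
Lemma young_powR_sqr r theta s t : 0 <= theta <= 1 -> r <= theta ->
  r <= 1 - theta -> 0 <= s -> 0 <= t ->
  (s ^+ 2) `^ theta * (t ^+ 2) `^ (1 - theta) + r * (s - t) ^+ 2 <=
  theta * s ^+ 2 + (1 - theta) * t ^+ 2.
Proof.
move=> /andP[th0 th1] rth rth' s0 t0; have [th2|th2] := leP theta 2^-1.
  exact: young_powR_sqr_le.
have th1' : 0 <= 1 - theta by lra.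
have th2' : 1 - theta <= 2^-1 by lra.
have := @young_powR_sqr_le _ _ _ _ th1' rth' th2' t0 s0; rewrite subKr.
by rewrite -(sqrrN (t - s)) opprB [_ * (s ^+ 2) `^ _]mulrC [leRHS]addrC.
Qed.

Lemma half_powR_sqr a p : 0 <= a -> (a `^ (p / 2)) ^+ 2 = a `^ p.
Proof.
by move=> a0; rewrite -powR_mulrn ?powR_ge0// -powRrM; congr (_ `^ _); field.
Qed.

(** Uniform convexity of the p-th power, for all p > 1 at once and with an
    explicit constant. The sharpened Young inequality at (a, m) and at (b, m),
    where m is the midpoint, bounds a * m ^(p-1) and b * m ^(p-1); these add up
    to 2 * m ^p, and the two remainders dominate half the square of the
    difference of a ^(p/2) and b ^(p/2). *)
Lemma powR_midpoint_gap r p a b : 1 < p -> r <= p^-1 -> r <= 1 - p^-1 -> 0 <= r ->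
  0 <= a -> 0 <= b ->
  ((a + b) / 2) `^ p + p * r / 4 * (a `^ (p / 2) - b `^ (p / 2)) ^+ 2 <=
  (a `^ p + b `^ p) / 2.
Proof.
move=> p1 rp rp' r0 a0 b0; set m := (a + b) / 2.
have m0 : 0 <= m by rewrite /m; lra.
have p0 : 0 < p by lra.
have pV : 0 <= p^-1 <= 1 by rewrite invr_ge0 invf_le1// !ltW.
have key z : 0 <= z -> z * m `^ (p - 1) +
    r * (z `^ (p / 2) - m `^ (p / 2)) ^+ 2 <= p^-1 * z `^ p + (1 - p^-1) * m `^ p.
  move=> z0.
  have := @young_powR_sqr r p^-1 (z `^ (p / 2)) (m `^ (p / 2)) pV rp rp'
    (powR_ge0 _ _) (powR_ge0 _ _).
  rewrite !half_powR_sqr// -!powRrM mulfV ?gt_eqF// powRr1//.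
  by rewrite mulrBr mulr1 mulfV ?gt_eqF.
have mp : m * m `^ (p - 1) = m `^ p.
  rewrite -{1}(powRr1 m0) -powRD; first by congr (_ `^ _); ring.
  by rewrite addrC subrK gt_eqF.
have := lerD (key a a0) (key b b0).
set s := a `^ (p / 2); set t := b `^ (p / 2); set M := m `^ (p / 2).
set q := m `^ (p - 1) in mp *; set w := m `^ p in mp *.
have ab : b = 2 * m - a by rewrite /m; field.
have -> : a * q + r * (s - M) ^+ 2 + (b * q + r * (t - M) ^+ 2) =
    2 * w + r * ((s - M) ^+ 2 + (t - M) ^+ 2) by rewrite -mp [in b * q]ab; ring.
have : r * ((s - t) ^+ 2 / 2) <= r * ((s - M) ^+ 2 + (t - M) ^+ 2).
  by apply: ler_wpM2l => //; have := sqr_ge0 (s + t - 2 * M); nra.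
move=> h1 h2.
have {h1 h2} h : 2 * w + r * ((s - t) ^+ 2 / 2) <=
    p^-1 * a `^ p + (1 - p^-1) * w + (p^-1 * b `^ p + (1 - p^-1) * w) by lra.
have {h} := ler_wpM2l (ltW p0) h.
have -> : p * (p^-1 * a `^ p + (1 - p^-1) * w + (p^-1 * b `^ p + (1 - p^-1) * w))
   = a `^ p + b `^ p + 2 * (p - 1) * w by field; rewrite gt_eqF.
by nra.
Qed.

Lemma powR_superadd p a b : 1 <= p -> 0 <= a -> 0 <= b ->
  a `^ p + b `^ p <= (a + b) `^ p.
Proof.
move=> p1 a0 b0; have [ab0|abn0] := eqVneq (a + b) 0.
  have [-> ->] : a = 0 /\ b = 0 by lra.
  by rewrite addr0 powR0 ?addr0// gt_eqF//; lra.
have ab0 : 0 < a + b by rewrite lt_def abn0 addr_ge0.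
have key z : 0 <= z -> z <= a + b -> z `^ p <= z * (a + b) `^ (p - 1).
  rewrite le_eqVlt => /predU1P[<- _|z0 zab].
    by rewrite mul0r powR0// gt_eqF//; lra.
  have zp : z `^ p = z * z `^ (p - 1).
    rewrite -[X in X * _](powRr1 (ltW z0)) -powRD ?(gt_eqF z0) ?implybT//.
    by congr (_ `^ _); ring.
  rewrite zp ler_pM2l//; apply: ge0_ler_powR; rewrite ?nnegrE//; lra.
rewrite (_ : (a + b) `^ p = a * (a + b) `^ (p - 1) + b * (a + b) `^ (p - 1)).
  by apply: lerD; apply: key => //; lra.
rewrite -mulrDl -[X in X * _](powRr1 (ltW ab0)) -powRD ?abn0 ?implybT//.
by congr (_ `^ _); ring.
Qed.

(** Superadditivity of the p-th power gives |a - b|^p <= |a^p - b^p|, which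
    factors as |s - t| * (s + t) with s, t the powers p/2; the parameter c
    weights the two factors, and optimizing it after integration amounts to the
    Cauchy-Schwarz inequality. *)
Lemma powR_dist_le p c a b : 1 <= p -> 0 < c -> 0 <= a -> 0 <= b ->
  `|a - b| `^ p <= c / 2 * (a `^ (p / 2) - b `^ (p / 2)) ^+ 2
                   + c^-1 * (a `^ p + b `^ p).
Proof.
move=> p1 c0; wlog ba : a b / b <= a.
  move=> wl a0 b0; have [|/ltW] := leP b a; first by move/wl; exact.
  by move=> /wl/(_ b0 a0); rewrite distrC (addrC (a `^ p)) -(sqrrN (_ - _)) opprB.
move=> a0 b0; rewrite ger0_norm ?subr_ge0//.
have := @powR_superadd p (a - b) b p1.
rewrite subrK subr_ge0 => /(_ ba b0); rewrite -(half_powR_sqr p a0) -(half_powR_sqr p b0).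
set s := a `^ (p / 2); set t := b `^ (p / 2) => h.
have ci : 0 < c^-1 by rewrite invr_gt0.
have cc : c^-1 * c = 1 by rewrite mulVf ?gt_eqF.
set k := c^-1 in ci cc *; clearbody k s t.
(* AM-GM for the factors of s^2 - t^2 = (s - t) * (s + t). *)
have h1 : 0 <= (k / 2) * (c * (s - t) - (s + t)) ^+ 2.
  by rewrite mulr_ge0 ?sqr_ge0// divr_ge0// ltW.
have e1 : (k / 2) * (c * (s - t) - (s + t)) ^+ 2 = (k * c) * c / 2 * (s - t) ^+ 2
   - (k * c) * (s ^+ 2 - t ^+ 2) + k / 2 * (s + t) ^+ 2.
  by field.
rewrite e1 cc !mul1r in h1.
have : 0 <= k / 2 * (s - t) ^+ 2 by rewrite mulr_ge0 ?sqr_ge0// divr_ge0// ltW.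
nra.
Qed.

(** Joint convexity of (u, a) |-> u^2 / a, with v standing for u^2 / a; the
    product form stays meaningful at a = 0. *)
Lemma sqr_midpoint_le u0 u v v0 a a0 : 0 <= v -> 0 <= v0 -> 0 <= a -> 0 <= a0 ->
  u ^+ 2 <= v * a -> u0 ^+ 2 <= v0 * a0 ->
  (2^-1 * u + 2^-1 * u0) ^+ 2 <= (v + v0) / 2 * ((a + a0) / 2).
Proof.
move=> v_ge0 v0_ge0 a_ge0 a0_ge0 uva u0va.
have va0 : 0 <= v * a0 by rewrite mulr_ge0.
have v0a : 0 <= v0 * a by rewrite mulr_ge0.
have : (2 * (u * u0)) ^+ 2 <= (v * a0 + v0 * a) ^+ 2.
  have : u ^+ 2 * u0 ^+ 2 <= (v * a) * (v0 * a0) by rewrite ler_pM ?sqr_ge0.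
  have := sqr_ge0 (v * a0 - v0 * a); nra.
rewrite -real_normK ?num_real// ler_sqr ?nnegrE ?addr_ge0// => /(le_trans (ler_norm _)).
nra.
Qed.

End scalar_inequalities.

(** * Integral inequalities *)

Section integral_inequalities.
Context d (T : measurableType d) (R : realType) (mu : {measure set T -> \bar R}).
Variables (D : set T) (mD : measurable D).
Implicit Types (a b F G u v : T -> R) (p r theta : R).

Lemma integral_lincomb_le c k P M F G : 0 <= c -> 0 <= k ->
  measurable_fun D F -> measurable_fun D G ->
  (forall x, D x -> 0 <= F x) -> (forall x, D x -> 0 <= G x) ->
  (\int[mu]_(x in D) (F x)%:E <= P%:E)%E ->
  (\int[mu]_(x in D) (G x)%:E <= M%:E)%E ->
  (\int[mu]_(x in D) (c * F x + k * G x)%:E <= (c * P + k * M)%:E)%E.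
Proof.
move=> c0 k0 mF mG F0 G0 FP GM.
have mE H : measurable_fun D H -> measurable_fun D (EFin \o H).
  by move=> mH; apply/measurable_EFinP.
under eq_integral do rewrite EFinD !EFinM.
rewrite ge0_integralD//; last 4 first.
- by move=> x /F0 ?; rewrite mule_ge0.
- by apply: emeasurable_funM => //; exact: mE.
- by move=> x /G0 ?; rewrite mule_ge0.
- by apply: emeasurable_funM => //; exact: mE.
rewrite !ge0_integralZl_EFin//; [|exact: mE..].
by rewrite EFinD !EFinM leeD// lee_wpmul2l.
Qed.

(** Hoelder's inequality in the exponents theta and 1 - theta, for upper bounds
    P and M of the two integrals rather than for their values, so that it can be
    fed with the bound on the midpoint directly. *)
Lemma integral_powR_interpolation theta P M F G : 0 <= theta <= 1 ->
  0 < P -> 0 < M -> measurable_fun D F -> measurable_fun D G ->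
  (forall x, D x -> 0 <= F x) -> (forall x, D x -> 0 <= G x) ->
  (\int[mu]_(x in D) (F x)%:E <= P%:E)%E ->
  (\int[mu]_(x in D) (G x)%:E <= M%:E)%E ->
  (\int[mu]_(x in D) (F x `^ theta * G x `^ (1 - theta))%:E <=
     (P `^ theta * M `^ (1 - theta))%:E)%E.
Proof.
move=> th P0 M0 mF mG F0 G0 FP GM; have /andP[th0 th1] := th.
set C := P `^ theta * M `^ (1 - theta).
have C0 : 0 <= C by rewrite mulr_ge0// powR_ge0.
have mp H t : measurable_fun D H -> measurable_fun D (fun x => H x `^ t).
  by move=> mH; exact: (measurableT_comp (measurable_powR t)).
have c0 : 0 <= C * (theta / P) by rewrite mulr_ge0// divr_ge0// ltW.
have k0 : 0 <= C * ((1 - theta) / M) by rewrite mulr_ge0// divr_ge0// ?subr_ge0// ltW.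
apply: (@le_trans _ _ (\int[mu]_(x in D)
    (C * (theta / P) * F x + C * ((1 - theta) / M) * G x)%:E)%E).
  apply: ge0_le_integral => //.
  - by move=> x Dx; rewrite lee_fin mulr_ge0// powR_ge0.
  - by apply/measurable_EFinP/measurable_funM; exact: mp.
  - by apply/measurable_EFinP/measurable_funD; exact: measurable_funM.
  move=> x Dx; rewrite lee_fin.
  have FP0 : 0 <= F x / P by rewrite divr_ge0 ?F0// ltW.
  have GM0 : 0 <= G x / M by rewrite divr_ge0 ?G0// ltW.
  have -> : F x `^ theta * G x `^ (1 - theta) =
      C * ((F x / P) `^ theta * (G x / M) `^ (1 - theta)).
    rewrite /C mulrACA -powRM ?(ltW P0)// -powRM ?(ltW M0)//.
    by rewrite !mulrA ![_ * F x]mulrC ![_ * G x]mulrC !mulfK ?gt_eqF.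
  have -> : C * (theta / P) * F x + C * ((1 - theta) / M) * G x =
      C * (theta * (F x / P) + (1 - theta) * (G x / M)) by ring.
  by rewrite ler_wpM2l// young_powR.
apply: (le_trans (@integral_lincomb_le _ _ _ _ _ _ c0 k0 mF mG F0 G0 FP GM)).
have -> : C * (theta / P) * P + C * ((1 - theta) / M) * M = C => //.
by field; rewrite !gt_eqF.
Qed.

Lemma measurable_fun_powR a p : measurable_fun D a ->
  measurable_fun D (fun x => a x `^ p).
Proof. by move=> mH; exact: (measurableT_comp (measurable_powR p)). Qed.

(** The integrated convexity gap: two functions of norm at most 1 that are far
    apart have a midpoint of norm well below 1. *)
Lemma integral_powR_midpoint_le r p (G : R) a b : 1 < p -> r <= p^-1 -> r <= 1 - p^-1 ->
  0 <= r -> measurable_fun D a -> measurable_fun D b ->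
  (forall x, D x -> 0 <= a x) -> (forall x, D x -> 0 <= b x) ->
  (\int[mu]_(x in D) (a x `^ p)%:E <= 1)%E ->
  (\int[mu]_(x in D) (b x `^ p)%:E <= 1)%E ->
  (\int[mu]_(x in D) ((a x `^ (p / 2) - b x `^ (p / 2)) ^+ 2)%:E = G%:E)%E ->
  (\int[mu]_(x in D) (((a x + b x) / 2) `^ p)%:E <= (1 - p * r / 4 * G)%:E)%E.
Proof.
move=> p1 rp rp' r0 ma mb a0 b0 ia ib iG.
have prg : 0 <= p * r / 4 by rewrite divr_ge0// mulr_ge0//; lra.
have mm : measurable_fun D (fun x => ((a x + b x) / 2) `^ p).
  by apply: measurable_fun_powR; apply: measurable_funM => //; exact: measurable_funD.
have mG : measurable_fun D (fun x => (a x `^ (p / 2) - b x `^ (p / 2)) ^+ 2).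
  apply: measurable_funX; apply: measurable_funB; exact: measurable_fun_powR.
rewrite EFinB leeBrDr// EFinM -iG -ge0_integralZl_EFin//; last first.
  exact/measurable_EFinP.
  by move=> x _; rewrite lee_fin sqr_ge0.
rewrite -ge0_integralD//; last 4 first.
- by move=> x _; rewrite lee_fin powR_ge0.
- exact/measurable_EFinP.
- by move=> x _; rewrite -EFinM lee_fin mulr_ge0 ?sqr_ge0.
- by apply/measurable_EFinP/measurable_funM.
apply: (@le_trans _ _ (\int[mu]_(x in D)
    (2^-1 * a x `^ p + 2^-1 * b x `^ p)%:E)%E).
  apply: ge0_le_integral => //.
  - by move=> x Dx; rewrite -EFinM -EFinD lee_fin addr_ge0 ?powR_ge0// mulr_ge0 ?sqr_ge0.
  - by apply: emeasurable_funD; apply/measurable_EFinP => //; exact: measurable_funM.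
  - apply/measurable_EFinP/measurable_funD; apply: measurable_funM => //;
    exact: measurable_fun_powR.
  move=> x Dx; rewrite -EFinM -EFinD lee_fin -mulrDr [leRHS]mulrC.
  exact: powR_midpoint_gap (a0 _ Dx) (b0 _ Dx).
have h2 : 0 <= 2^-1 :> R by [].
apply: (le_trans (@integral_lincomb_le _ _ 1 1 _ _ h2 h2 _ _ _ _ ia ib)).
- exact: measurable_fun_powR.
- exact: measurable_fun_powR.
- by move=> x _; exact: powR_ge0.
- by move=> x _; exact: powR_ge0.
by rewrite lee_fin !mulr1; lra.
Qed.

Lemma integral_sqr_powR_half_le p a b :
  measurable_fun D a -> measurable_fun D b ->
  (forall x, D x -> 0 <= a x) -> (forall x, D x -> 0 <= b x) ->
  (\int[mu]_(x in D) (a x `^ p)%:E <= 1)%E ->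
  (\int[mu]_(x in D) (b x `^ p)%:E <= 1)%E ->
  (\int[mu]_(x in D) ((a x `^ (p / 2) - b x `^ (p / 2)) ^+ 2)%:E <= 2%:E)%E.
Proof.
move=> ma mb a0 b0 ia ib.
have mp := measurable_fun_powR.
have e2 : (2 = 1 * 1 + 1 * 1 :> R) by lra.
rewrite e2; apply: le_trans; last first.
  apply: (@integral_lincomb_le _ _ _ _ _ _ ler01 ler01 (mp _ p ma) (mp _ p mb) _ _ ia ib).
  - by move=> x _; exact: powR_ge0.
  - by move=> x _; exact: powR_ge0.
apply: ge0_le_integral => //.
- by move=> x Dx; rewrite lee_fin sqr_ge0.
- by apply/measurable_EFinP/measurable_funX/measurable_funB; exact: mp.
- by apply/measurable_EFinP/measurable_funD; apply: measurable_funM => //; exact: mp.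
move=> x Dx; rewrite lee_fin !mul1r -(half_powR_sqr p (a0 _ Dx)).
rewrite -(half_powR_sqr p (b0 _ Dx)).
have := mulr_ge0 (powR_ge0 (a x) (p / 2)) (powR_ge0 (b x) (p / 2)). nra.
Qed.

(** Equivalent to a Cauchy-Schwarz inequality; it is obtained from the bound
    I <= c / 2 * G + 2 / c, valid for all c > 0, at c = 4 / I. *)
Lemma integral_powR_dist_sqr_le p (G : R) a b : 1 <= p ->
  measurable_fun D a -> measurable_fun D b ->
  (forall x, D x -> 0 <= a x) -> (forall x, D x -> 0 <= b x) ->
  (\int[mu]_(x in D) (a x `^ p)%:E <= 1)%E ->
  (\int[mu]_(x in D) (b x `^ p)%:E <= 1)%E ->
  (\int[mu]_(x in D) ((a x `^ (p / 2) - b x `^ (p / 2)) ^+ 2)%:E = G%:E)%E ->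
  exists I, (\int[mu]_(x in D) (`|a x - b x| `^ p)%:E = I%:E)%E /\ I ^+ 2 <= 4 * G.
Proof.
move=> p1 ma mb a0 b0 ia ib iG.
have mp := measurable_fun_powR.
have md : measurable_fun D (fun x => `|a x - b x| `^ p).
  by apply: mp; apply: measurableT_comp => //; exact: measurable_funB.
have mG : measurable_fun D (fun x => (a x `^ (p / 2) - b x `^ (p / 2)) ^+ 2).
  by apply: measurable_funX; apply: measurable_funB; exact: mp.
have key c : 0 < c ->
    (\int[mu]_(x in D) (`|a x - b x| `^ p)%:E <= (c / 2 * G + c^-1 * 2)%:E)%E.
  move=> c0.
  have c2 : 0 <= c / 2 by lra.
  have ci : 0 <= c^-1 by rewrite invr_ge0 ltW.
  have mab : measurable_fun D (fun x => a x `^ p + b x `^ p).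
    by apply: measurable_funD; exact: mp.
  have iab : (\int[mu]_(x in D) (a x `^ p + b x `^ p)%:E <= 2%:E)%E.
    have e2 : (2 = 1 * 1 + 1 * 1 :> R) by lra.
    have := @integral_lincomb_le _ _ _ _ _ _ ler01 ler01 (mp _ p ma) (mp _ p mb)
      (fun _ _ => powR_ge0 _ _) (fun _ _ => powR_ge0 _ _) ia ib.
    by rewrite e2; under eq_integral do rewrite !mul1r.
  have ab0 x : D x -> 0 <= a x `^ p + b x `^ p by rewrite addr_ge0// powR_ge0.
  have := @integral_lincomb_le _ _ _ _ _ _ c2 ci mG mab (fun _ _ => sqr_ge0 _) ab0 _ iab.
  rewrite iG => /(_ _ (lexx _)); apply: le_trans.
  apply: ge0_le_integral => //.
  - exact/measurable_EFinP.
  - by apply/measurable_EFinP/measurable_funD; apply: measurable_funM.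
  by move=> x Dx; rewrite lee_fin powR_dist_le// ?a0 ?b0.
have I0 : (0 <= \int[mu]_(x in D) (`|a x - b x| `^ p)%:E)%E.
  by apply: integral_ge0 => x _; rewrite lee_fin powR_ge0.
have [I IE] : exists I, (\int[mu]_(x in D) (`|a x - b x| `^ p)%:E = I%:E)%E.
  exists (fine (\int[mu]_(x in D) (`|a x - b x| `^ p)%:E)); rewrite fineK//.
  by rewrite ge0_fin_numE// (le_lt_trans (key _ ltr01))// ltry.
exists I; split=> //; move: key I0; rewrite IE => key.
rewrite lee_fin le_eqVlt => /predU1P[<-|I0].
  rewrite expr0n/= mulr_ge0//.
  by rewrite -lee_fin -iG; apply: integral_ge0 => x _; rewrite lee_fin sqr_ge0.
(* c = 4 / I makes the terms c / 2 * G and 2 / c combine to I^2 <= 4 * G. *)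
have := key (4 / I); rewrite divr_gt0// lee_fin => /(_ isT).
rewrite invf_div => h.
have : I * I <= I * (4 / I / 2 * G + I / 4 * 2) by rewrite ler_pM2l.
have -> : I * (4 / I / 2 * G + I / 4 * 2) = 2 * G + I * I / 2.
  by field; rewrite gt_eqF.
rewrite expr2; lra.
Qed.

(** The heart of the argument. With V = 1 / a and v = V u^2, the right-hand side
    is the mean of the two potential energies, reduced by a factor coming from
    the convexity gap between a and a0. The relation between
    u, v and a is written as a product, which makes sense where a vanishes. *)
Lemma integral_powR_mean_le r p (G Q K : R) u u0 v v0 a a0 :
  1 < p -> r <= p^-1 -> r <= 1 - p^-1 -> 0 <= r -> 0 < Q + K ->
  measurable_fun D u -> measurable_fun D u0 ->
  measurable_fun D v -> measurable_fun D v0 ->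
  measurable_fun D a -> measurable_fun D a0 ->
  (forall x, D x -> 0 <= v x) -> (forall x, D x -> 0 <= v0 x) ->
  (forall x, D x -> 0 <= a x) -> (forall x, D x -> 0 <= a0 x) ->
  {ae mu, forall x, D x -> u x ^+ 2 <= v x * a x} ->
  {ae mu, forall x, D x -> u0 x ^+ 2 <= v0 x * a0 x} ->
  (\int[mu]_(x in D) (v x)%:E <= Q%:E)%E ->
  (\int[mu]_(x in D) (v0 x)%:E <= K%:E)%E ->
  (\int[mu]_(x in D) (a x `^ p)%:E <= 1)%E ->
  (\int[mu]_(x in D) (a0 x `^ p)%:E <= 1)%E ->
  (\int[mu]_(x in D) ((a x `^ (p / 2) - a0 x `^ (p / 2)) ^+ 2)%:E = G%:E)%E ->
  ((\int[mu]_(x in D) (`|2^-1 * u x + 2^-1 * u0 x| `^ (2 * p / (p + 1)))%:E)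
     `^ ((p + 1) / p) <= ((Q + K) / 2 * (1 - r / 4 * G))%:E)%E.
Proof.
move=> p1 rp rp' r0 QK mu_ mu0 mv mv0 ma ma0 v_ge0 v0_ge0 a_ge0 a0_ge0 uva uva0.
move=> iv iv0 ia ia0 iG.
have p0 : 0 < p by lra.
have p10 : 0 < p + 1 by lra.
have h2 : 0 <= 2^-1 :> R by [].
have G2 : G <= 2.
  by rewrite -lee_fin -iG; exact: integral_sqr_powR_half_le.
have G0 : 0 <= G.
  by rewrite -lee_fin -iG; apply: integral_ge0 => x _; rewrite lee_fin sqr_ge0.
have pr1 : p * r <= 1.
  by rewrite -(@mulfV _ p) ?gt_eqF// ler_wpM2l// ltW.
set theta := p / (p + 1).
have th1 : 1 - theta = (p + 1)^-1 by rewrite /theta; field; rewrite gt_eqF.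
have th : 0 <= theta <= 1.
  apply/andP; split; first by rewrite divr_ge0// ltW.
  by rewrite ler_pdivrMr//; lra.
set P := (Q + K) / 2; set M := 1 - p * r / 4 * G.
have P0 : 0 < P by rewrite divr_gt0.
(* As p * r <= 1 and G <= 2, the gap p * r / 4 * G is at most 1 / 2. *)
have M0 : 0 < M.
  have : p * r * G <= 1 * 2 by apply: ler_pM => //; rewrite mulr_ge0// ltW.
  by rewrite /M; lra.
have mF : measurable_fun D (fun x => 2^-1 * v x + 2^-1 * v0 x).
  by apply: measurable_funD; apply: measurable_funM.
have mm : measurable_fun D (fun x => (a x + a0 x) / 2).
  by apply: measurable_funM => //; exact: measurable_funD.
have mG : measurable_fun D (fun x => ((a x + a0 x) / 2) `^ p).
  exact: measurable_fun_powR.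
have F0 x : D x -> 0 <= 2^-1 * v x + 2^-1 * v0 x.
  by move=> Dx; rewrite addr_ge0// mulr_ge0// ?v_ge0 ?v0_ge0.
have iF : (\int[mu]_(x in D) (2^-1 * v x + 2^-1 * v0 x)%:E <= P%:E)%E.
  apply: (le_trans (@integral_lincomb_le _ _ _ _ _ _ h2 h2 mv mv0 _ _ iv iv0)) => //.
  by rewrite lee_fin /P; lra.
have iM : (\int[mu]_(x in D) (((a x + a0 x) / 2) `^ p)%:E <= M%:E)%E.
  exact: integral_powR_midpoint_le.
have := @integral_powR_interpolation _ _ _ _ _ th P0 M0 mF mG F0
  (fun _ _ => powR_ge0 _ _) iF iM.
set X := (X in (X <= _)%E) => iX.
have mw : measurable_fun D (fun x => 2^-1 * u x + 2^-1 * u0 x).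
  by apply: measurable_funD; apply: measurable_funM.
have {iX} : (\int[mu]_(x in D) (`|2^-1 * u x + 2^-1 * u0 x| `^ (2 * p / (p + 1)))%:E
    <= (P `^ theta * M `^ (1 - theta))%:E)%E.
  apply: le_trans iX; apply: ae_ge0_le_integral => //.
  - apply/measurable_EFinP; apply: measurable_fun_powR => //.
    exact: measurableT_comp.
  - by move=> x _; rewrite lee_fin mulr_ge0// powR_ge0.
  - apply/measurable_EFinP; apply: measurable_funM => //;
    exact: measurable_fun_powR.
  apply: filterS2 uva uva0 => x uvax uva0x Dx; rewrite lee_fin.
  have m0 : 0 <= (a x + a0 x) / 2 by rewrite divr_ge0// addr_ge0 ?a_ge0 ?a0_ge0.
  rewrite -powRrM (_ : p * (1 - theta) = theta); last first.
    by rewrite /theta; field; rewrite gt_eqF.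
  rewrite -powRM ?F0// (_ : 2 * p / (p + 1) = 2%:R * theta); last first.
    by rewrite /theta mulrA.
  rewrite powRrM powR_mulrn// real_normK ?num_real//.
  have -> : 2^-1 * v x + 2^-1 * v0 x = (v x + v0 x) / 2 by lra.
  have le2 : (2^-1 * u x + 2^-1 * u0 x) ^+ 2 <=
      (v x + v0 x) / 2 * ((a x + a0 x) / 2).
    by apply: sqr_midpoint_le; rewrite ?v_ge0 ?v0_ge0 ?a_ge0 ?a0_ge0 ?uvax ?uva0x.
  apply: ge0_ler_powR; rewrite ?nnegrE ?sqr_ge0//; first by case/andP: th.
  exact: (le_trans (sqr_ge0 _) le2).
set I := (X in (X <= _)%E -> _) => IPM.
have I0 : (0 <= I)%E by apply: integral_ge0 => x _; rewrite lee_fin powR_ge0.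
have PM0 : 0 <= P `^ theta * M `^ (1 - theta) by rewrite mulr_ge0// powR_ge0.
have pp0 : 0 <= (p + 1) / p by rewrite divr_ge0// ltW.
apply: (@le_trans _ _ ((P `^ theta * M `^ (1 - theta))%:E `^ ((p + 1) / p))%E).
  by apply: gt0_ler_poweR => //; rewrite in_itv/= ?I0 ?leey ?lee_fin ?PM0.
rewrite poweR_EFin lee_fin powRM ?powR_ge0// -!powRrM.
rewrite (_ : theta * _ = 1); last by rewrite /theta; field; rewrite !gt_eqF.
rewrite (_ : (1 - theta) * _ = p^-1); last by rewrite th1; field; rewrite !gt_eqF.
rewrite powRr1 ?(ltW P0)//. apply: ler_wpM2l; first exact: ltW.
have pV : 0 <= p^-1 <= 1 by rewrite invr_ge0 invf_le1// !ltW.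
(* Bernoulli's inequality for the exponent 1 / p. *)
have := @young_powR _ p^-1 M 1 pV (ltW M0) ler01.
rewrite powR1 mulr1 => /le_trans; apply; rewrite mulr1 /M.
have -> : p^-1 * (1 - p * r / 4 * G) = p^-1 - r / 4 * G by field; rewrite gt_eqF.
lra.
Qed.

End integral_inequalities.

(** * Reciprocals of extended real potentials *)

Section ereal_potentials.
Context d (T : measurableType d) (R : realType) (mu : {measure set T -> \bar R}).
Variables (D : set T) (mD : measurable D).
Implicit Types (u : T -> R) (V U : T -> \bar R) (p : R).

Lemma measurable_inve : measurable_fun [set: \bar R] (@inve R).
Proof.
rewrite (_ : @inve R = fun x => if x == 0%E then +oo%E else
   if x == +oo%E then 0%E else if x == -oo%E then -oo%E else (fine x)^-1%:E); last first.
  by apply/funext => -[r||] //=; rewrite inver eqe.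
have me (c : \bar R) : measurable_fun [set: \bar R] (fun x => x == c).
  by apply: measurable_fun_eqe => //; exact: measurable_cst.
apply: measurable_fun_ifT => //; apply: measurable_fun_ifT => //.
apply: measurable_fun_ifT => //; apply/measurable_EFinP.
rewrite (_ : (fun x => _) = fun x : \bar R => fine x * `|fine x| `^ (- 2%:R)).
  have mf : measurable_fun [set: \bar R] (@fine R) by [].
  apply: measurable_funM => //; apply: (measurableT_comp (measurable_powR _)).
  exact: measurableT_comp.
apply/funext => x; rewrite powRN powR_mulrn// real_normK ?num_real//.
have [->|x0] := eqVneq (fine x) 0; first by rewrite invr0 mul0r.
by rewrite expr2 invfM mulVKf.
Qed.

Lemma fine_inve_ge0 V x : (0 <= V x)%E -> 0 <= fine (V x)^-1.
Proof. by move=> V0; rewrite fine_ge0// inve_ge0. Qed.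

(** Replacing +oo by the default value 0 can only decrease the integrand. *)
Lemma integral_fine_le (F : T -> \bar R) : measurable_fun D F ->
  (forall x, D x -> 0 <= F x)%E ->
  (\int[mu]_(x in D) (fine (F x))%:E <= \int[mu]_(x in D) F x)%E.
Proof.
move=> mF F0; apply: ge0_le_integral => //.
- by move=> x /F0 ?; rewrite lee_fin fine_ge0.
- by apply/measurable_EFinP; exact: measurableT_comp.
by move=> x /F0; case: (F x) => //= _; rewrite leey.
Qed.

Lemma ae_fin_num_integral (F : T -> \bar R) : measurable_fun D F ->
  (forall x, D x -> 0 <= F x)%E -> (\int[mu]_(x in D) F x < +oo)%E ->
  {ae mu, forall x, D x -> F x \is a fin_num}.
Proof.
move=> mF F0 iF; apply: integrable_ae => //; apply/integrableP; split => //.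
apply: le_lt_trans iF; rewrite le_eqVlt; apply/orP; left; apply/eqP.
by apply: eq_integral => x /set_mem /F0 /gee0_abs.
Qed.

Section reciprocal.
Variables (p : R) (p0 : 0 < p).
Variables (V : T -> \bar R) (mV : measurable_fun D V).
Hypothesis V0 : forall x, D x -> (0 <= V x)%E.
Hypothesis iV : (\int[mu]_(x in D) ((V x)^-1 `^ p) <= 1)%E.

Lemma measurable_inve_fun : measurable_fun D (fun x => (V x)^-1)%E.
Proof. exact: (measurableT_comp measurable_inve). Qed.

Lemma measurable_fine_inve : measurable_fun D (fun x => fine (V x)^-1).
Proof. by apply: measurableT_comp => //; exact: measurable_inve_fun. Qed.

Let miV : measurable_fun D (fun x => (V x)^-1 `^ p)%E.
Proof. exact: (measurableT_comp (measurable_poweR p) measurable_inve_fun). Qed.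

Lemma integral_fine_inve_powR :
  (\int[mu]_(x in D) ((fine (V x)^-1) `^ p)%:E <= 1)%E.
Proof.
apply: le_trans iV; under eq_integral do rewrite -fine_poweR.
by apply: integral_fine_le => // x _; exact: poweR_ge0.
Qed.

(** Where V vanishes, V^-p is +oo. *)
Lemma ae_potential_neq0 : {ae mu, forall x, D x -> V x != 0%E}.
Proof.
have := @ae_fin_num_integral _ miV (fun _ _ => poweR_ge0 _ _) (le_lt_trans iV (ltry _)).
apply: filterS => x /[apply]; apply: contraTN => /eqP ->.
by rewrite inve0 poweRyr ?gt_eqF.
Qed.

Variable (u : T -> R) (mu_ : measurable_fun D u).

Lemma measurable_potential_energy : measurable_fun D (fun x => V x * (u x ^+ 2)%:E)%E.
Proof.
apply: emeasurable_funM => //; apply/measurable_EFinP; exact: measurable_funX.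
Qed.

Lemma potential_energy_ge0 x : D x -> (0 <= V x * (u x ^+ 2)%:E)%E.
Proof. by move=> Dx; rewrite mule_ge0 ?V0// lee_fin sqr_ge0. Qed.

(** Where V is +oo and u is not 0, the potential energy density is +oo, so that
    happens on a null set only; where V vanishes the left-hand side need not,
    but that is a null set as well. *)
Lemma ae_sqr_le_potential : (\int[mu]_(x in D) (V x * (u x ^+ 2)%:E) < +oo)%E ->
  {ae mu, forall x, D x ->
    u x ^+ 2 <= fine (V x * (u x ^+ 2)%:E) * fine (V x)^-1}.
Proof.
move=> /(ae_fin_num_integral measurable_potential_energy potential_energy_ge0).
apply: filterS2 ae_potential_neq0 => x Vx0 + Dx.
move=> /(_ Dx); move: (Vx0 Dx) (V0 Dx).
case: (V x) => [r|_ _|]//.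
  rewrite eqe => r0 _ _; rewrite -EFinM/= fine_invr mulrAC mulfV ?mul1r//.
have [->|u0 ] := eqVneq (u x) 0; first by rewrite expr0n/= mule0 mul0r.
by rewrite gt0_mulye// lte_fin exprn_even_gt0.
Qed.

End reciprocal.

Lemma Lnorm_inve_dist p V U : 0 < p ->
  measurable_fun D V -> measurable_fun D U ->
  (forall x, D x -> 0 <= V x)%E -> (forall x, D x -> 0 <= U x)%E ->
  (\int[mu]_(x in D) ((V x)^-1 `^ p) <= 1)%E ->
  (\int[mu]_(x in D) ((U x)^-1 `^ p) <= 1)%E ->
  ('N[mu]_p%:E [ (fun x => (V x)^-1 - (U x)^-1) \_ D ] `^ p =
   \int[mu]_(x in D) (`|fine (V x)^-1 - fine (U x)^-1| `^ p)%:E)%E.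
Proof.
move=> p0 mV mU V0 U0 iV iU.
rewrite poweR_Lnorm ?gt_eqF//.
transitivity (\int[mu]_(x in D) (`|(V x)^-1 - (U x)^-1| `^ p))%E.
  rewrite [RHS]integral_mkcond; apply: eq_integral => x _.
  rewrite !patchE; case: ifPn => // _.
  by rewrite abse0 poweR0r// gt_eqF.
have mp := @measurable_poweR R p.
apply: ge0_ae_eq_integral => //.
- apply: (measurableT_comp mp); apply: measurableT_comp => //.
  by apply: emeasurable_funB; exact: measurable_inve_fun.
- apply/measurable_EFinP/measurable_fun_powR; apply: measurableT_comp => //.
  by apply: measurable_funB; exact: measurable_fine_inve.
- by move=> x _; exact: poweR_ge0.
apply: filterS2 (ae_potential_neq0 p0 mV iV) (ae_potential_neq0 p0 mU iU).
move=> x Vx Ux Dx.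
have fin (W : \bar R) : (0 <= W)%E -> W != 0%E -> W^-1%E = (fine W^-1)%:E.
  by case: W => [r _| |] //; rewrite eqe => r0; rewrite inver (negPf r0).
by rewrite (fin _ (V0 _ Dx) (Vx Dx)) (fin _ (U0 _ Dx) (Ux Dx)) -EFinB /= .
Qed.
End ereal_potentials.

(** * Linear combinations in the Sobolev space *)

Section test_functions.
Context {R : realType} {N : nat}.
Implicit Types (Omega : set 'rV[R]_N) (u v phi psi : 'rV[R]_N -> R)
  (g h : 'rV[R]_N -> 'rV[R]_N) (a b : R).

Lemma partial_lincomb a b phi psi i : (forall x, differentiable phi x) ->
  (forall x, differentiable psi x) ->
  partial i (a *: phi + b *: psi) = a *: partial i phi + b *: partial i psi.
Proof.
move=> dphi dpsi; apply/funext => x; rewrite /partial.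
have dp : derivable phi x (delta_mx ord0 i) by exact: diff_derivable.
have dq : derivable psi x (delta_mx ord0 i) by exact: diff_derivable.
by rewrite deriveD ?deriveZ//; exact: derivableZ.
Qed.

Lemma foldr_partial_lincomb a b phi psi s : smooth phi -> smooth psi ->
  foldr (@partial R N) (a *: phi + b *: psi) s =
  a *: foldr (@partial R N) phi s + b *: foldr (@partial R N) psi s.
Proof.
by move=> sphi spsi; elim: s => //= i s ->; rewrite partial_lincomb.
Qed.

Lemma smooth_lincomb a b phi psi : smooth phi -> smooth psi ->
  smooth (a *: phi + b *: psi).
Proof.
move=> sphi spsi s x; rewrite foldr_partial_lincomb//.
by apply: differentiableD; exact: differentiableZ.
Qed.

Lemma test_function_lincomb Omega a b phi psi : test_function Omega phi ->
  test_function Omega psi -> test_function Omega (a *: phi + b *: psi).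
Proof.
move=> [sphi cphi phiO] [spsi cpsi psiO].
have sub : closure [set x | (a *: phi + b *: psi) x != 0] `<=`
    closure [set x | phi x != 0] `|` closure [set x | psi x != 0].
  rewrite -closureU; apply: closureS => x /=.
  have [p0|] := eqVneq (phi x) 0; last by left.
  have [q0|] := eqVneq (psi x) 0; last by right.
  by rewrite fctE !fctE p0 q0 !scaler0 addr0 eqxx.
split; first exact: smooth_lincomb.
  apply: (subclosed_compact _ (compactU cphi cpsi) sub); exact: closed_closure.
by apply: subset_trans sub _ => x [/phiO|/psiO].
Qed.

Lemma gradient_lincomb a b phi psi x : smooth phi -> smooth psi ->
  gradient (a *: phi + b *: psi) x = a *: gradient phi x + b *: gradient psi x.
Proof.
move=> sphi spsi; apply/rowP => i; rewrite !mxE partial_lincomb//.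
  exact: (sphi [::]).
exact: (spsi [::]).
Qed.

Lemma continuous_measurable_rV phi : continuous phi -> measurable_fun setT phi.
Proof.
move=> cphi; apply: (measurability _ (RGenOpens.measurableE R)).
move=> _ [_ [a [b ->]] <-]; rewrite setTI; apply: open_measurable_rV.
by apply: open_comp; [move=> x _; exact: cphi|exact: interval_open].
Qed.

Lemma smooth_measurable phi : smooth phi -> measurable_fun setT phi.
Proof.
move=> sphi; apply: continuous_measurable_rV => x.
exact/differentiable_continuous/(sphi [::]).
Qed.

Lemma smooth_partial phi i : smooth phi -> smooth (partial i phi).
Proof. by move=> sphi s; have := sphi (rcons s i); rewrite foldr_rcons. Qed.

Lemma measurable_gradient phi : smooth phi -> measurable_fun setT (gradient phi).
Proof.
move=> sphi; apply/measurable_fun_rVP => i.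
rewrite (_ : _ \o _ = partial i phi); first by apply: smooth_measurable; exact: smooth_partial.
by apply/funext => x; rewrite /= /rV_coord mxE.
Qed.

Lemma enorm_sqr (x : 'rV[R]_N) : enorm x ^+ 2 = \sum_i x ord0 i ^+ 2.
Proof. by rewrite /enorm sqr_sqrtr// sumr_ge0// => i _; exact: sqr_ge0. Qed.

Lemma enorm_sqr_lincomb a b (x y : 'rV[R]_N) :
  enorm (a *: x + b *: y) ^+ 2 <=
  2 * a ^+ 2 * enorm x ^+ 2 + 2 * b ^+ 2 * enorm y ^+ 2.
Proof.
rewrite !enorm_sqr !mulr_sumr -big_split/=; apply: ler_sum => i _.
rewrite !mxE; have := sqr_ge0 (a * x ord0 i - b * y ord0 i); nra.
Qed.

Lemma measurable_enorm_sqr Omega g : measurable_fun Omega g ->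
  measurable_fun Omega (fun x => enorm (g x) ^+ 2).
Proof.
move=> mg; rewrite (_ : (fun x => _) = fun x => \sum_i g x ord0 i ^+ 2).
  apply: measurable_sum => i; apply: measurable_funX.
  exact: (measurableT_comp (measurable_rV_coord i)).
by apply/funext => x; rewrite enorm_sqr.
Qed.

Lemma measurable_fun_rV_lincomb Omega a b g h : measurable_fun Omega g ->
  measurable_fun Omega h -> measurable_fun Omega (fun x => a *: g x + b *: h x).
Proof.
move=> mg mh mO; apply: (measurability (\big[setU/set0]_(i < N)
  preimage_set_system setT (@rV_coord R N i) measurable)) => //.
move=> _ [B + <-]; rewrite -bigcup_seq/= => -[i _ [C mC <-]].
rewrite setTI -comp_preimage.
have mc (k : 'rV[R]_N -> 'rV[R]_N) : measurable_fun Omega k ->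
    measurable_fun Omega (fun x => rV_coord i (k x)).
  by move=> mk; exact: (measurableT_comp (measurable_rV_coord i)).
have : measurable_fun Omega (fun x => a * g x ord0 i + b * h x ord0 i).
  by apply: measurable_funD; apply: measurable_funM => //; exact: mc.
move=> /(_ mO C mC); congr (measurable (_ `&` _)).
by apply/seteqP; split=> x; rewrite /= /rV_coord !mxE.
Qed.

Lemma dirichlet_ge0 Omega g : (0 <= dirichlet Omega g)%E.
Proof. by apply: integral_ge0 => x _; rewrite lee_fin sqr_ge0. Qed.

Lemma dirichlet_lincomb Omega a b g h : measurable Omega ->
  measurable_fun Omega g -> measurable_fun Omega h ->
  (dirichlet Omega (fun x => a *: g x + b *: h x)%R <=
   (2 * a ^+ 2)%:E * dirichlet Omega g + (2 * b ^+ 2)%:E * dirichlet Omega h)%E.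
Proof.
move=> mO mg mh.
have ma : 0 <= 2 * a ^+ 2 by rewrite mulr_ge0// sqr_ge0.
have mb : 0 <= 2 * b ^+ 2 by rewrite mulr_ge0// sqr_ge0.
have mE (k : 'rV[R]_N -> 'rV[R]_N) : measurable_fun Omega k ->
    measurable_fun Omega (fun x => (enorm (k x) ^+ 2)%:E).
  by move=> mk; apply/measurable_EFinP; exact: measurable_enorm_sqr.
rewrite /dirichlet.
rewrite -!ge0_integralZl_EFin//; last 4 first.
- by move=> x _; rewrite lee_fin sqr_ge0.
- exact: mE.
- by move=> x _; rewrite lee_fin sqr_ge0.
- exact: mE.
rewrite -ge0_integralD//; last 4 first.
- by move=> x _; rewrite -EFinM lee_fin mulr_ge0// sqr_ge0.
- by apply: emeasurable_funM => //; exact: mE.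
- by move=> x _; rewrite -EFinM lee_fin mulr_ge0// sqr_ge0.
- by apply: emeasurable_funM => //; exact: mE.
apply: ge0_le_integral => //.
- by move=> x _; rewrite lee_fin sqr_ge0.
- by apply: mE; exact: measurable_fun_rV_lincomb.
- by apply: emeasurable_funD; apply: emeasurable_funM => //;
    exact: mE.
by move=> x _; rewrite -!EFinM -EFinD lee_fin enorm_sqr_lincomb.
Qed.

Lemma W012_lincomb Omega a b u v g h : measurable Omega ->
  W012 Omega u g -> W012 Omega v h ->
  W012 Omega (fun x => a * u x + b * v x) (fun x => a *: g x + b *: h x).
Proof.
move=> mO [mu mg [phi [tphi cphi aphi]]] [mv mh [psi [tpsi cpsi apsi]]].
split.
- by apply: measurable_funD; apply: measurable_funM.
- exact: measurable_fun_rV_lincomb.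
exists (fun n => a *: phi n + b *: psi n); split.
- by move=> n; exact: test_function_lincomb.
- have mD (f : nat -> 'rV[R]_N -> R) (k : 'rV[R]_N -> 'rV[R]_N) n :
      smooth (f n) -> measurable_fun Omega k ->
      measurable_fun Omega (fun x => gradient (f n) x - k x).
    move=> sf mk; rewrite (_ : (fun x => _) =
      fun x => 1 *: gradient (f n) x + (-1) *: k x).
      apply: measurable_fun_rV_lincomb => //.
      by apply: measurable_funTS; exact: measurable_gradient.
    by apply/funext => x; rewrite scale1r scaleN1r.
  apply: (@squeeze_cvge _ _ _ _ (cst 0%E) _ (fun n =>
    (2 * a ^+ 2)%:E * dirichlet Omega (fun x => gradient (phi n) x - g x)%R
    + (2 * b ^+ 2)%:E * dirichlet Omega (fun x => gradient (psi n) x - h x)%R)%E).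
  + apply: nearW => n; rewrite dirichlet_ge0/=.
    have [sphi _ _] := tphi n; have [spsi _ _] := tpsi n.
    apply: le_trans (dirichlet_lincomb _ _ mO (mD _ _ _ sphi mg) (mD _ _ _ spsi mh)).
    rewrite le_eqVlt; apply/orP; left; apply/eqP; congr dirichlet.
    apply/funext => x; rewrite gradient_lincomb// !scalerBr opprD addrACA //.
  + exact: cvg_cst.
  + rewrite -[X in _ --> X]adde0; apply: cvgeD => //.
    * by rewrite -(mule0 (2 * a ^+ 2)%:E); apply: cvgeZl.
    * by rewrite -(mule0 (2 * b ^+ 2)%:E); apply: cvgeZl.
apply: filterS2 aphi apsi => x phix psix Ox.
by apply: cvgD; apply: cvgMr; [exact: phix|exact: psix].
Qed.

End test_functions.

(** * Test functions have finite energy *)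

Section finite_energy.
Context {R : realType}.

(** The norm of row vectors is the sup norm, so balls are boxes. *)
Lemma rV_ball0 n (M : R) (x : 'rV[R]_n) :
  ball (0 : 'rV[R]_n) M x <-> 0 < M /\ forall i, `|x ord0 i| < M.
Proof.
split=> [[M0 xM]|[M0 xM]]; split=> // i.
  by have := xM ord0 i; rewrite /ball/= mxE sub0r normrN.
by move=> j; rewrite /ball/= mxE sub0r normrN ord1.
Qed.

(** By induction along the construction of the measure: a box is the product of
    an interval and a box of one dimension less. *)
Lemma lebesgue_rV_ball_fin n (M : R) : (lebesgue_rV n (ball (0 : 'rV[R]_n) M)%R < +oo)%E.
Proof.
have [M0|M0] := ltP 0 M; last first.
  rewrite (_ : ball _ _ = set0) ?measure0//; apply/seteqP; split=> // x /=.
  by move=> /rV_ball0[]; rewrite ltNge M0.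
elim: n => [|n IHn].
  by rewrite /= /dirac /= ltry.
have mB k : measurable (ball (0 : 'rV[R]_k) M).
  by apply: open_measurable_rV; exact: ball_open.
rewrite /= /leb_step /pushforward.
rewrite (_ : _ @^-1` _ = `]-M, M[%classic `*` ball (0 : 'rV[R]_n) M); last first.
  apply/seteqP; split=> -[x v].
    move=> /rV_ball0[_ xvM]; split => /=.
      by have := xvM ord0; rewrite mxE unlift_none in_itv/= -ltr_norml.
    apply/rV_ball0; split=> // i.
    by have := xvM (lift ord0 i); rewrite mxE liftK.
  move=> [/= xM /rV_ball0[_ vM]]; apply/rV_ball0; split=> // i.
  rewrite mxE; case: (unliftP ord0 i) => [j _|_] //.
  by move: xM; rewrite in_itv/= ltr_norml.
rewrite product_measure1E//; last exact: mB.
have oo : ((@lebesgue_measure R) `](- M)%R, M[%classic < +oo)%E.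
  by rewrite lebesgue_measure_itv/=; case: ifPn => _; rewrite ?ltry.
by rewrite lte_mul_pinfty// ge0_fin_numE.
Qed.

Lemma compact_measurable_rV n (A : set 'rV[R]_n) : compact A -> measurable A.
Proof.
move=> cA; rewrite -(setCK A); apply: measurableC; apply: open_measurable_rV.
by apply: closed_openC; apply: compact_closed => //; exact: norm_hausdorff.
Qed.

Lemma compact_lebesgue_rV_fin n (A : set 'rV[R]_n) : compact A ->
  (lebesgue_rV n A < +oo)%E.
Proof.
move=> cA; have [M [_ AM]] := compact_bounded cA.
have mA : measurable A by exact: compact_measurable_rV.
apply: (le_lt_trans _ (lebesgue_rV_ball_fin n (`|M| + 2))).
apply: le_measure; rewrite ?inE//; first by apply: open_measurable_rV; exact: ball_open.
move=> x Ax; rewrite -ball_normE/= sub0r normrN.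
apply: (@le_lt_trans _ _ (`|M| + 1)); last by rewrite ltrD2l ltr1n.
by apply: AM => //; rewrite ltr_pwDr// ler_norm.
Qed.

Context {N : nat}.
Implicit Types (Omega : set 'rV[R]_N) (phi : 'rV[R]_N -> R).

Lemma compact_support_bounded (A : set 'rV[R]_N) phi : compact A ->
  continuous phi -> (forall x, ~ A x -> phi x = 0) ->
  exists2 C, 0 <= C & forall x, `|phi x| <= C.
Proof.
move=> cA cphi phi0.
have : compact (phi @` A).
  by apply: continuous_compact => //; exact: continuous_subspaceT.
move=> /compact_bounded[M [_ hM]]; exists (`|M| + 1); first by rewrite addr_ge0.
move=> x; have [Ax|/phi0 ->] := pselect (A x); last by rewrite normr0 addr_ge0.
by apply: (hM (`|M| + 1)); [rewrite ltr_pwDr// ler_norm|exists x].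
Qed.

Lemma integral_compact_support_fin Omega (A : set 'rV[R]_N) (F : 'rV[R]_N -> R) C :
  measurable Omega -> compact A -> measurable_fun Omega F -> 0 <= C ->
  (forall x, 0 <= F x <= C) -> (forall x, ~ A x -> F x = 0) ->
  (\int[lebesgue_rV N]_(x in Omega) (F x)%:E < +oo)%E.
Proof.
move=> mO cA mF C0 FC F0.
have mA : measurable A by exact: compact_measurable_rV.
apply: (@le_lt_trans _ _ (\int[lebesgue_rV N]_(x in Omega) (C%:E * (\1_A x)%:E))%E).
  apply: ge0_le_integral => //.
  - by move=> x _; rewrite lee_fin; case/andP: (FC x).
  - exact/measurable_EFinP.
  - by apply: emeasurable_funM => //; exact/measurable_EFinP.
  move=> x _; rewrite -EFinM lee_fin indicE.
  have [xA|/negP xA] := boolP (x \in A); first by rewrite mulr1; case/andP: (FC x).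
  by rewrite mulr0 F0// => /mem_set.
rewrite ge0_integralZl_EFin//; last exact/measurable_EFinP.
rewrite integral_indic// lte_mul_pinfty// ?lee_fin//.
apply: le_lt_trans (compact_lebesgue_rV_fin cA).
by apply: le_measure; rewrite ?inE//; exact: measurableI.
Qed.

(** The derivative is local, and phi vanishes near x. *)
Lemma partial_eq0 phi i x : ~ closure [set x | phi x != 0] x ->
  partial i phi x = 0.
Proof.
move=> /existsNP[B /not_implyP[nB /nonemptyPn B0]].
rewrite /partial (_ : 0 = 'D_(delta_mx ord0 i) (cst 0 : 'rV[R]_N -> R) x); last first.
  by rewrite derive_cst.
apply: near_eq_derive.
apply: filterS nB => y By; apply: contrapT => /eqP py.
by have : ([set x | phi x != 0] `&` B) y by []; rewrite B0.
Qed.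

Lemma test_function_dirichlet_fin Omega phi : measurable Omega ->
  test_function Omega phi -> (dirichlet Omega (gradient phi) < +oo)%E.
Proof.
move=> mO [sphi cphi _].
have /choice[C HC] : forall i, exists C, forall x, `|partial i phi x| <= C.
  move=> i; have [|x|C _ HC] := @compact_support_bounded _ (partial i phi) cphi.
  - by move=> x; apply: differentiable_continuous; exact: (sphi [:: i]).
  - exact: partial_eq0.
  - by exists C.
apply: (@integral_compact_support_fin _ _ _ (\sum_i C i ^+ 2) mO cphi).
- by apply: measurable_enorm_sqr; apply: measurable_funTS; exact: measurable_gradient.
- by apply: sumr_ge0 => i _; exact: sqr_ge0.
- move=> x; rewrite sqr_ge0/= enorm_sqr; apply: ler_sum => i _.
  rewrite mxE -real_normK ?num_real// ler_sqr ?nnegrE//.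
  exact: le_trans (HC i x).
- move=> x Ax; rewrite enorm_sqr big1// => i _.
  by rewrite mxE partial_eq0// expr0n.
Qed.

Lemma test_function_int_pow_fin (p : R) Omega phi : 0 < p -> measurable Omega ->
  test_function Omega phi -> (int_pow p Omega phi < +oo)%E.
Proof.
move=> p0 mO [sphi cphi _].
have q0 : 0 < 2 * p / (p + 1) by rewrite divr_gt0// ?mulr_gt0// addr_gt0.
have phi0 x : ~ closure [set x | phi x != 0] x -> phi x = 0.
  by move=> h; apply: contrapT => /eqP px; apply: h; exact: subset_closure.
have [x|C C0 HC] := @compact_support_bounded _ phi cphi _ phi0.
  by apply: differentiable_continuous; exact: (sphi [::]).
apply: (@integral_compact_support_fin _ _ _ (C `^ (2 * p / (p + 1))) mO cphi).
- apply: measurable_fun_powR; apply: measurableT_comp => //.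
  by apply: measurable_funTS; exact: smooth_measurable.
- exact: powR_ge0.
- by move=> x; rewrite powR_ge0/= ge0_ler_powR ?nnegrE// ltW.
- by move=> x /phi0 ->; rewrite normr0 powR0// gt_eqF.
Qed.

Lemma test_function_W012 Omega phi : test_function Omega phi ->
  W012 Omega phi (gradient phi).
Proof.
move=> tphi; have [sphi _ _] := tphi; split.
- by apply: measurable_funTS; exact: smooth_measurable.
- by apply: measurable_funTS; exact: measurable_gradient.
exists (fun=> phi); split => //.
- apply: cvg_near_cst; apply: nearW => n; rewrite /dirichlet integral0_eq// => x _.
  by rewrite subrr enorm_sqr big1// => i _; rewrite mxE expr0n.
- by apply: aeW => x _; exact: cvg_cst.
Qed.

Lemma test_function0 Omega : test_function Omega (cst 0 : 'rV[R]_N -> R).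
Proof.
have e : [set x : 'rV[R]_N | (cst 0 : 'rV[R]_N -> R) x != 0] = set0.
  by apply/seteqP; split=> x //=; rewrite eqxx.
split; rewrite ?e ?closure0//; last exact: compact0.
elim/last_ind => [|s i IHs] x /=.  exact: (differentiable_cst 0).
rewrite foldr_rcons (_ : partial i (cst 0) = cst 0)//.
by apply/funext => y; rewrite /partial derive_cst.
Qed.

(** A function that vanishes almost everywhere has the gradient 0, whatever
    gradient it was given: the zero test functions converge to it. *)
Lemma W012_ae0 Omega u g : W012 Omega u g ->
  {ae lebesgue_rV N, forall x, Omega x -> u x = 0} -> W012 Omega u (cst 0).
Proof.
move=> [mu mg _] u0; split => //.
exists (fun=> cst 0); split => //.
- by move=> n; exact: test_function0.
- apply: cvg_near_cst; apply: nearW => n; rewrite /dirichlet integral0_eq// => x _.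
  rewrite enorm_sqr big1// => i _.
  by rewrite !mxE /partial derive_cst subr0 expr0n.
- by apply: filterS u0 => x /[apply] ->; exact: cvg_cst.
Qed.

End finite_energy.

(** * The stability estimate *)

Section stability.
Context {R : realType} {N : nat}.
Variables (p : R) (p1 : (1 < p)%R).
Variables (Omega : set 'rV[R]_N) (mO : measurable Omega).
Implicit Types (u v phi : 'rV[R]_N -> R) (g h : 'rV[R]_N -> 'rV[R]_N)
  (V U : 'rV[R]_N -> \bar R).

(** The part of linearity that the stability estimate uses. It holds both for
    bounded linear forms and for the pairing with a function f, where L u = 0 is
    also the value given to u when f * u is not integrable. *)
Definition linear_off_kernel (L : ('rV[R]_N -> R) -> R) :=
  (forall a b u g v h, W012 Omega u g -> W012 Omega v h -> L u != 0 -> L v != 0 ->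
    L (fun x => a * u x + b * v x) = a * L u + b * L v) /\
  (forall u g, W012 Omega u g ->
    {ae lebesgue_rV N, forall x, Omega x -> u x = 0} -> L u = 0).

Variables (L : ('rV[R]_N -> R) -> R) (linL : linear_off_kernel L).

(** The largest r allowed in the sharpened Young inequality with weights 1 / p
    and 1 - 1 / p. *)
Definition gap_rate : R := Num.min p^-1 (1 - p^-1).

Lemma gap_rate_gt0 : 0 < gap_rate.
Proof.
by rewrite /gap_rate lt_min invr_gt0 subr_gt0 invf_lt1 ?(lt_trans ltr01 p1)// p1 andbT
  (lt_trans ltr01 p1).
Qed.

Lemma class_V2_energy_ge0 V u : class_V2 p Omega V ->
  (0 <= \int[lebesgue_rV N]_(x in Omega) (V x * (u x ^+ 2)%:E))%E.
Proof.
move=> [_ V0 _]; apply: integral_ge0 => x Ox.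
by rewrite mule_ge0 ?V0// lee_fin sqr_ge0.
Qed.

(** The first two terms on the right are half the Schroedinger energies of
    (u, V) and (v, U); the last one is the gain from the convexity gap. *)
Lemma J_midpoint_le V U u g v h (D Q E K G : R) :
  class_V2 p Omega V -> class_V2 p Omega U ->
  W012 Omega u g -> W012 Omega v h -> L u != 0 -> L v != 0 ->
  dirichlet Omega g = D%:E -> dirichlet Omega h = E%:E ->
  (\int[lebesgue_rV N]_(x in Omega) (V x * (u x ^+ 2)%:E) = Q%:E)%E ->
  (\int[lebesgue_rV N]_(x in Omega) (U x * (v x ^+ 2)%:E) = K%:E)%E ->
  0 < Q + K ->
  (\int[lebesgue_rV N]_(x in Omega) (((fine (V x)^-1) `^ (p / 2)
     - (fine (U x)^-1) `^ (p / 2)) ^+ 2)%:E = G%:E)%E ->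
  (J p Omega L (fun x => 2^-1 * u x + 2^-1 * v x)%R
               (fun x => 2^-1 *: g x + 2^-1 *: h x)%R <=
   (2^-1 * (2^-1 * D + 2^-1 * Q - L u) + 2^-1 * (2^-1 * E + 2^-1 * K - L v)
    - gap_rate / 16 * (Q + K) * G)%:E)%E.
Proof.
move=> [mV V0 iV] [mU U0 iU] Wu Wv Lu Lv DE EE QE KE QK GE.
have p0 : 0 < p := lt_trans ltr01 p1.
have [mu mg _] := Wu; have [mv mh _] := Wv.
rewrite /J (linL.1 _ _ _ _ _ _ Wu Wv Lu Lv).
have hD := dirichlet_lincomb 2^-1 2^-1 mO mg mh.
have Vu := measurable_potential_energy mV mu.
have Uv := measurable_potential_energy mU mv.
have Vu0 := potential_energy_ge0 V0 u.
have Uv0 := potential_energy_ge0 U0 v.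
have hB := @integral_powR_mean_le _ _ _ (lebesgue_rV N) Omega mO gap_rate p G Q K
  u v (fun x => fine (V x * (u x ^+ 2)%:E)%E) (fun x => fine (U x * (v x ^+ 2)%:E)%E)
  (fun x => fine (V x)^-1) (fun x => fine (U x)^-1) p1.
have {hB} hB : (int_pow p Omega (fun x => 2^-1 * u x + 2^-1 * v x)%R `^ ((p + 1) / p) <=
    ((Q + K) / 2 * (1 - gap_rate / 4 * G))%:E)%E.
  apply: hB => //.
  - by rewrite /gap_rate ge_min lexx.
  - by rewrite /gap_rate ge_min lexx orbT.
  - exact: ltW gap_rate_gt0.
  - by apply: measurableT_comp.
  - by apply: measurableT_comp.
  - exact: measurable_fine_inve.
  - exact: measurable_fine_inve.
  - by move=> x Ox; rewrite fine_ge0 ?Vu0.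
  - by move=> x Ox; rewrite fine_ge0 ?Uv0.
  - by move=> x Ox; rewrite fine_inve_ge0 ?V0.
  - by move=> x Ox; rewrite fine_inve_ge0 ?U0.
  - by apply: (ae_sqr_le_potential _ p0) => //; rewrite QE ltry.
  - by apply: (ae_sqr_le_potential _ p0) => //; rewrite KE ltry.
  - by rewrite -QE; apply: integral_fine_le.
  - by rewrite -KE; apply: integral_fine_le.
  - exact: integral_fine_inve_powR.
  - exact: integral_fine_inve_powR.
have h2 : (0 <= 2^-1 :> R) by [].
move: hD; rewrite DE EE -!EFinM -EFinD => hD.
apply: (@le_trans _ _ ((2^-1)%:E * (2 * 2^-1 ^+ 2 * D + 2 * 2^-1 ^+ 2 * E)%:E +
   (2^-1)%:E * ((Q + K) / 2 * (1 - gap_rate / 4 * G))%:E -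
   (2^-1 * L u + 2^-1 * L v)%:E)%E).
  by rewrite leeB// leeD// lee_wpmul2l// lee_fin.
by rewrite -!EFinM -!EFinD lee_fin; lra.
Qed.

(** Along multiples of phi the linear term dominates the quadratic ones near 0,
    so J takes negative values. This rules out u0 = 0 as a minimizer. *)
Lemma J_negative phi : test_function Omega phi -> L phi != 0 ->
  exists u g, W012 Omega u g /\ (J p Omega L u g < 0)%E.
Proof.
move=> tphi Lphi; have p0 : 0 < p := lt_trans ltr01 p1.
have Wphi := test_function_W012 tphi.
have [mphi mg _] := Wphi.
have [D DE] : exists D, dirichlet Omega (gradient phi) = D%:E.
  exists (fine (dirichlet Omega (gradient phi))); rewrite fineK//.
  by rewrite ge0_fin_numE ?dirichlet_ge0// test_function_dirichlet_fin.
have D0 : 0 <= D by rewrite -lee_fin -DE dirichlet_ge0.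
have I0 : (0 <= int_pow p Omega phi)%E.
  by apply: integral_ge0 => x _; rewrite lee_fin powR_ge0.
have [I IE] : exists I, int_pow p Omega phi = I%:E.
  exists (fine (int_pow p Omega phi)); rewrite fineK//.
  by rewrite ge0_fin_numE// test_function_int_pow_fin.
have {}I0 : 0 <= I by rewrite -lee_fin -IE.
pose B := I `^ ((p + 1) / p).
have B0 : 0 <= B by exact: powR_ge0.
(* At t = s * L phi the quadratic terms add up to less than the linear one; the
   summand 1 keeps the denominator positive. *)
pose s := (D + B / 2 + 1)^-1.
have s0 : 0 < s by rewrite invr_gt0; lra.
have sDB : s * (D + B / 2) < 1.
  by rewrite /s mulrC ltr_pdivrMr; lra.
pose t := s * L phi.
exists (fun x => t * phi x + 0 * phi x), (fun x => t *: gradient phi x + 0 *: gradient phi x).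
split; first exact: W012_lincomb.
rewrite /J (linL.1 _ _ _ _ _ _ Wphi Wphi Lphi Lphi) mul0r addr0.
have hD := dirichlet_lincomb t 0 mO mg mg.
rewrite expr0n/= mulr0 mul0e adde0 DE -EFinM in hD.
have -> : int_pow p Omega (fun x => t * phi x + 0 * phi x)%R = (`|t| `^ (2 * p / (p + 1)) * I)%:E.
  rewrite EFinM -IE /int_pow -ge0_integralZl_EFin//.
  - by apply: eq_integral => x _; rewrite mul0r addr0 normrM powRM.
  - apply/measurable_EFinP; apply: measurable_fun_powR; exact: measurableT_comp.
rewrite poweR_EFin powRM ?powR_ge0// -powRrM -/B.
rewrite (_ : 2 * p / (p + 1) * _ = 2%:R); last by field; rewrite !gt_eqF//; lra.
rewrite powR_mulrn// real_normK ?num_real//.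
apply: (@le_lt_trans _ _ ((2^-1)%:E * (2 * t ^+ 2 * D)%:E +
   (2^-1)%:E * (t ^+ 2 * B)%:E - (t * L phi)%:E)%E).
  by rewrite leeB// leeD// lee_wpmul2l// lee_fin.
rewrite -!EFinM -!EFinD lte_fin.
have L2 : 0 < L phi ^+ 2 by rewrite exprn_even_gt0.
have -> : 2^-1 * (2 * t ^+ 2 * D) + 2^-1 * (t ^+ 2 * B) - t * L phi =
  s * L phi ^+ 2 * (s * (D + B / 2) - 1) by rewrite /t; field.
by rewrite pmulr_rlt0 ?subr_lt0// mulr_gt0.
Qed.

Section optimal.
Variables (u0 : 'rV[R]_N -> R) (A : R).
Hypothesis mu0 : measurable_fun Omega u0.
Hypothesis A0 : 0 < A.
Hypothesis AE : int_pow p Omega u0 = A%:E.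
Let U0 := optimal_potential p Omega u0.

Lemma optimal_potentialE x :
  U0 x = ((A `^ p^-1)%:E * (`|u0 x| `^ (2 / (p + 1)))%:E^-1)%E.
Proof. by rewrite /U0 /optimal_potential AE poweR_EFin. Qed.

(** Unlike U0 itself, its reciprocal is finite everywhere. *)
Lemma inve_optimal_potential x :
  ((U0 x)^-1 = (`|u0 x| `^ (2 / (p + 1)) / A `^ p^-1)%:E)%E.
Proof.
have A0' : 0 < A `^ p^-1 by rewrite powR_gt0.
rewrite optimal_potentialE; set y := `|u0 x| `^ _.
rewrite [in LHS]inver; case: eqVneq => [->|y0].
  by rewrite gt0_muley ?lte_fin// invey mul0r.
by rewrite -EFinM inver mulf_eq0 invr_eq0 (negPf y0) gt_eqF//= invfM invrK mulrC.
Qed.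

Lemma optimal_potential_V2 : class_V2 p Omega U0.
Proof.
have p0 : 0 < p := lt_trans ltr01 p1.
have A0' : 0 < A `^ p^-1 by rewrite powR_gt0.
have miU : measurable_fun Omega (fun x => (`|u0 x| `^ (2 / (p + 1)) / A `^ p^-1)%:E).
  apply/measurable_EFinP; apply: measurable_funM => //.
  by apply: measurable_fun_powR; exact: measurableT_comp.
split.
- rewrite (_ : U0 = fun x => (`|u0 x| `^ (2 / (p + 1)) / A `^ p^-1)%:E^-1%E).
    exact: (measurableT_comp (@measurable_inve R) miU).
  by apply/funext => x; rewrite -inve_optimal_potential inveK.
- by move=> x _; rewrite -inve_ge0 inve_optimal_potential lee_fin divr_ge0 ?powR_ge0.
under eq_integral => x _.
  rewrite inve_optimal_potential poweR_EFin.
  rewrite (_ : (_ `^ p)%R = A^-1 * `|u0 x| `^ (2 * p / (p + 1))); last first.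
    rewrite powRM ?powR_ge0 ?invr_ge0 ?powR_ge0// -powRrM mulrC -powRN -powRrM.
    by rewrite mulNr mulVf ?gt_eqF// powR_inv1 ?ltW//; congr (_ * _ `^ _); rewrite mulrAC.
  rewrite EFinM; over.
rewrite ge0_integralZl_EFin//; last 2 first.
  by apply/measurable_EFinP; apply: measurable_fun_powR; exact: measurableT_comp.
  by rewrite invr_ge0 ltW.
by rewrite -/(int_pow p Omega u0) AE -EFinM mulVf ?gt_eqF.
Qed.

Lemma optimal_potential_energy :
  (\int[lebesgue_rV N]_(x in Omega) (U0 x * (u0 x ^+ 2)%:E) = (A `^ ((p + 1) / p))%:E)%E.
Proof.
have p0 : 0 < p := lt_trans ltr01 p1.
have A0' : 0 < A `^ p^-1 by rewrite powR_gt0.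
under eq_integral => x _.
  rewrite (_ : (U0 x * _)%E = (A `^ p^-1)%:E * (`|u0 x| `^ (2 * p / (p + 1)))%:E)%E; last first.
    rewrite optimal_potentialE; have [->|u0x] := eqVneq (u0 x) 0.
      rewrite expr0n/= mule0 normr0 [in RHS]powR0 ?mule0//.
      by rewrite gt_eqF// divr_gt0// ?mulr_gt0//; lra.
    have y0 : 0 < `|u0 x| by rewrite normr_gt0.
    rewrite inver gt_eqF ?powR_gt0// -!EFinM; congr EFin.
    rewrite -mulrA; congr (_ * _).
    rewrite -(real_normK (num_real (u0 x))) -powR_mulrn// -powRN -powRD; last first.
      by rewrite (gt_eqF y0) implybT.
    by congr (_ `^ _); field; rewrite gt_eqF//; lra.
  over.
rewrite ge0_integralZl_EFin//; last 2 first.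
  by apply/measurable_EFinP; apply: measurable_fun_powR; exact: measurableT_comp.
  exact: powR_ge0.
rewrite -/(int_pow p Omega u0) AE -EFinM; congr EFin.
rewrite -{2}(powRr1 (ltW A0)) -powRD ?(gt_eqF A0) ?implybT//.
by congr (_ `^ _); field; rewrite gt_eqF.
Qed.

End optimal.

(** I stands for the integral of |1/V - 1/U|^p; its square is the 2p-th power of
    the distance, which explains the exponent of the theorem. *)
Lemma inv_dist_poweR V U : class_V2 p Omega V -> class_V2 p Omega U ->
  exists G I : R, [/\ 0 <= G <= 2, I ^+ 2 <= 4 * G,
    (\int[lebesgue_rV N]_(x in Omega) (((fine (V x)^-1) `^ (p / 2)
     - (fine (U x)^-1) `^ (p / 2)) ^+ 2)%:E = G%:E)%E &
    (inv_dist p Omega V U `^ (2 * p) = (I ^+ 2)%:E)%E].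
Proof.
move=> [mV V0 iV] [mU U0 iU]; have p0 : 0 < p := lt_trans ltr01 p1.
have ma := measurable_fine_inve mV; have mb := measurable_fine_inve mU.
have a0 x : Omega x -> 0 <= fine (V x)^-1 by move=> Ox; rewrite fine_inve_ge0 ?V0.
have b0 x : Omega x -> 0 <= fine (U x)^-1 by move=> Ox; rewrite fine_inve_ge0 ?U0.
have ia := integral_fine_inve_powR mO mV iV.
have ib := integral_fine_inve_powR mO mU iU.
have G2 := integral_sqr_powR_half_le mO ma mb a0 b0 ia ib.
set X := (X in (X <= 2%:E)%E) in G2.
have X0 : (0 <= X)%E by apply: integral_ge0 => x _; rewrite lee_fin sqr_ge0.
have [G GE] : exists G, X = G%:E.
  by exists (fine X); rewrite fineK// ge0_fin_numE// (le_lt_trans G2)// ltry.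
have [I [IE IG]] := integral_powR_dist_sqr_le mO (ltW p1) ma mb a0 b0 ia ib GE.
exists G, I; split=> //.
  by rewrite -!lee_fin -GE X0.
rewrite /inv_dist mulrC poweRrM (Lnorm_inve_dist mO p0 mV mU V0 U0 iV iU) IE.
rewrite poweR_EFin powR_mulrn// -lee_fin -IE.
by apply: integral_ge0 => x _; rewrite lee_fin powR_ge0.
Qed.

(** If L u = 0 the gap is at least - j0 and the distance is
    bounded, which gives the first entry of the minimum; otherwise the midpoint
    inequality applies and gives the second. *)
Lemma schroedinger_ge (u0 : 'rV[R]_N -> R) g0 U (K E0 : R) V u g :
  class_V2 p Omega V -> class_V2 p Omega U ->
  W012 Omega u0 g0 -> W012 Omega u g -> L u0 != 0 -> 0 < K ->
  dirichlet Omega g0 = E0%:E ->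
  (\int[lebesgue_rV N]_(x in Omega) (U x * (u0 x ^+ 2)%:E) = K%:E)%E ->
  let j0 := 2^-1 * E0 + 2^-1 * K - L u0 in j0 < 0 ->
  (forall v h, W012 Omega v h -> (j0%:E <= J p Omega L v h)%E) ->
  (j0%:E + (Num.min (- j0 / 8) (gap_rate * K / 32))%:E * inv_dist p Omega V U `^ (2 * p) <=
   schroedinger Omega L V u g)%E.
Proof.
move=> cV cU Wu0 Wu Lu0 K0 E0E KE j0 j0_lt0 minJ; set sigma := Num.min _ _.
have [G [I [/andP[G0 G2] IG GE NE]]] := inv_dist_poweR cV cU.
rewrite NE {NE}.
have Q0 := class_V2_energy_ge0 u cV; have D0 := dirichlet_ge0 Omega g.
have r0 := gap_rate_gt0.
have s8 : sigma <= - j0 / 8 by rewrite /sigma ge_min lexx.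
have s32 : sigma <= gap_rate * K / 32 by rewrite /sigma ge_min lexx orbT.
have sg0 : 0 < sigma.
  by rewrite /sigma lt_min !divr_gt0// ?mulr_gt0// oppr_gt0.
rewrite /schroedinger; move: Q0.
have [QE _|Qfin Q0] := eqVneq (\int[lebesgue_rV N]_(x in Omega) (V x * (u x ^+ 2)%:E))%E +oo%E.
  rewrite QE gt0_muley// addey ?addye ?leey//.
  by rewrite -ltNye (lt_le_trans (ltNyr 0))// mule_ge0.
move: D0.
have [DE _|Dfin D0] := eqVneq (dirichlet Omega g) +oo%E.
  rewrite DE gt0_muley// addye ?addye ?leey//.
  by rewrite -ltNye (lt_le_trans (ltNyr 0))// mule_ge0.
have [Q QE] : exists Q, (\int[lebesgue_rV N]_(x in Omega) (V x * (u x ^+ 2)%:E) = Q%:E)%E.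
  by eexists; symmetry; apply: fineK; rewrite ge0_fin_numE// ltey.
have [D DE] : exists D, dirichlet Omega g = D%:E.
  by eexists; symmetry; apply: fineK; rewrite ge0_fin_numE// ltey.
move: Q0 D0; rewrite QE DE !lee_fin => Q0 D0.
have sI : sigma * I ^+ 2 <= sigma * (4 * G) by rewrite ler_wpM2l// ltW.
have [Lu|Lu] := eqVneq (L u) 0.
  have : sigma * (4 * G) <= (- j0 / 8) * (4 * 2).
    by apply: ler_pM => //; [exact: ltW|rewrite mulr_ge0|rewrite ler_wpM2l].
  rewrite Lu; lra.
have QK : 0 < Q + K by rewrite ltr_wpDl.
have := J_midpoint_le cV cU Wu Wu0 Lu Lu0 DE E0E QE KE QK GE.
move=> /(le_trans (minJ _ _ (W012_lincomb _ _ mO Wu Wu0))).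
rewrite lee_fin => h.
have h1 : sigma * (4 * G) <= gap_rate * K / 32 * (4 * G).
  by rewrite ler_wpM2r// mulr_ge0.
have h2 : 0 <= gap_rate * Q * G by rewrite !mulr_ge0// ltW.
have e : gap_rate / 16 * (Q + K) * G = (gap_rate * Q * G + gap_rate * K * G) / 16.
  by field.
have e2 : gap_rate * K / 32 * (4 * G) = gap_rate * K * G / 8 by field.
move: h; rewrite e -/j0 => h; rewrite e2 in h1; lra.
Qed.

(** The bound sigma does not depend on V; optimality of U0 is the case where the
    distance term is dropped. *)
Lemma energy_stability_linear : energy_stability p (2 * p) Omega L.
Proof.
have p0 : 0 < p := lt_trans ltr01 p1.
move=> [phi [tphi /eqP Lphi]] u0 [g0 [Wu0 fin0 min0]] U0.
have [u1 [g1 [Wu1 J1]]] := J_negative tphi Lphi.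
have J0 := le_lt_trans (min0 _ _ Wu1) J1.
have [mu0 mg0 _] := Wu0.
have A_ge0 : (0 <= int_pow p Omega u0)%E.
  by apply: integral_ge0 => x _; rewrite lee_fin powR_ge0.
have [A AE] : exists A, int_pow p Omega u0 = A%:E.
  by eexists; symmetry; apply: fineK; rewrite ge0_fin_numE.
rewrite AE lee_fin in A_ge0.
pose K := A `^ ((p + 1) / p).
have JE : (J p Omega L u0 g0 =
    (2^-1)%:E * dirichlet Omega g0 + (2^-1 * K)%:E - (L u0)%:E)%E.
  by rewrite /J AE poweR_EFin -EFinM.
have D0 := dirichlet_ge0 Omega g0.
have [E0 E0E] : exists E0, dirichlet Omega g0 = E0%:E.
  eexists; symmetry; apply: fineK; rewrite ge0_fin_numE// ltey.
  apply/eqP => DE; move: J0; rewrite JE DE gt0_muley// !addye//.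
rewrite E0E lee_fin in D0.
pose j0 := 2^-1 * E0 + 2^-1 * K - L u0.
have {}JE : J p Omega L u0 g0 = j0%:E.
  by rewrite JE E0E -EFinM -!EFinD.
have j00 : j0 < 0 by rewrite -lte_fin -JE.
have K_ge0 : 0 <= K by exact: powR_ge0.
have Lu0 : L u0 != 0.
  by apply/eqP => Lu0; move: j00; rewrite /j0 Lu0; lra.
have A0 : 0 < A.
  rewrite lt_def A_ge0 andbT; apply/eqP => A0.
  move/eqP: Lu0; apply; apply: (linL.2 _ _ Wu0).
  have mq : measurable_fun Omega (fun x => `|u0 x| `^ (2 * p / (p + 1))).
    by apply: measurable_fun_powR; exact: measurableT_comp.
  have : ae_eq (lebesgue_rV N) Omega (fun x => (`|u0 x| `^ (2 * p / (p + 1)))%:E) (cst 0%E).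
    apply/ae_eq_integral_abs => //; first exact/measurable_EFinP.
    transitivity (int_pow p Omega u0); last by rewrite AE A0.
    apply: eq_integral => x _.
    by rewrite gee0_abs// lee_fin powR_ge0.
  apply: filterS => x /[apply] /= -[] /eqP.
  by rewrite powR_eq0 normr_eq0 => /andP[/eqP].
have cU := optimal_potential_V2 mu0 A0 AE.
have UE := optimal_potential_energy mu0 A0 AE.
have K0 : 0 < K by exact: powR_gt0.
have minJ v h : W012 Omega v h -> (j0%:E <= J p Omega L v h)%E.
  by rewrite -JE; exact: min0.
have eU : (energy Omega L U0 <= j0%:E)%E.
  apply: ereal_inf_lbound; exists u0, g0; split=> //.
  by rewrite /schroedinger UE E0E -!EFinM -!EFinD.
set sigma := Num.min (- j0 / 8) (gap_rate * K / 32).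
have sg0 : 0 < sigma.
  rewrite /sigma lt_min !divr_gt0// ?oppr_gt0// mulr_gt0//.
  exact: gap_rate_gt0.
have key V : class_V2 p Omega V ->
    (energy Omega L U0 + sigma%:E * inv_dist p Omega V U0 `^ (2 * p) <= energy Omega L V)%E.
  move=> cV; apply: le_ereal_inf_tmp => _ [u [g [Wu ->]]].
  apply: le_trans (schroedinger_ge cV cU Wu0 Wu Lu0 K0 E0E UE j00 minJ).
  by rewrite leeD2r.
split=> //.
  move=> V cV; apply: le_trans (key V cV).
  by rewrite leeDl// mule_ge0 ?poweR_ge0// lee_fin ltW.
by exists sigma; split.
Qed.

End stability.

(** * Pairings with functions and bounded linear forms *)

Section linear_forms.
Context {R : realType} {N : nat}.
Variables (Omega : set 'rV[R]_N) (mO : measurable Omega).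

(** If the integral of f * u were infinite or undefined, the pairing would be 0;
    a nonzero value therefore makes f * u integrable. *)
Lemma pairing_linear_off_kernel (f : 'rV[R]_N -> R) : measurable_fun Omega f ->
  linear_off_kernel Omega (pairing Omega f).
Proof.
move=> mf.
have mfu u : measurable_fun Omega u -> measurable_fun Omega (fun x => f x * u x).
  by move=> mu; exact: measurable_funM.
have int u : measurable_fun Omega u -> pairing Omega f u != 0 ->
    (lebesgue_rV N).-integrable Omega (EFin \o (fun x => f x * u x)).
  move=> mu fu0; apply/integrableP; split; first by apply/measurable_EFinP; exact: mfu.
  rewrite /= integral_fin_num_abs//; last exact: mfu.
  move: fu0; rewrite /pairing /Rintegral.
  by case: (integral _ _ _) => //=; rewrite eqxx.
split=> [a b u g v h [mu _ _] [mv _ _] fu0 fv0|u g [mu _ _] u0].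
  have iu := int _ mu fu0; have iv := int _ mv fv0.
  rewrite /pairing -RintegralZl// -RintegralZl// -RintegralD//.
  - by apply: eq_Rintegral => x _; rewrite mulrDr !mulrA ![f x * _]mulrC.
  - by have := integrableZl mO a iu; apply: eq_integrable.
  - by have := integrableZl mO b iv; apply: eq_integrable.
rewrite /pairing /Rintegral (@ae_eq_integral _ _ _ _ _ (cst 0%E))//.
- by rewrite integral0.
- by apply/measurable_EFinP; exact: mfu.
- by apply: filterS u0 => x /[apply] ->; rewrite mulr0.
Qed.

Lemma dual_linear_off_kernel (L : ('rV[R]_N -> R) -> R) : dual_W012 Omega L ->
  linear_off_kernel Omega L.
Proof.
move=> [linL [C CL]]; split.
  move=> a b u g v h Wu Wv _ _.
  have L0 : L (fun=> 0) = 0.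
    have W0 := test_function_W012 (test_function0 Omega).
    have := linL 1 _ _ _ _ W0 W0.
    rewrite (_ : (fun x => _) = (fun=> 0)); last by apply/funext => x; rewrite mulr0 addr0.
    rewrite mul1r /cst => /eqP; rewrite eq_sym -subr_eq0 addrK => /eqP; exact.
  have W0 := test_function_W012 (test_function0 Omega).
  have Wbv := W012_lincomb b 0 mO Wv W0.
  rewrite (_ : (fun x => b * v x + 0 * cst 0 x) = (fun x => b * v x + cst 0 x)) in Wbv.
    have := linL a _ _ _ _ Wu Wbv; rewrite (linL b _ _ _ _ Wv W0).
    rewrite /cst L0 addr0 => <-; congr L; apply/funext => x.
    by rewrite addr0.
  by apply/funext => x; rewrite mul0r.
move=> u g Wu u0; have := CL _ _ (W012_ae0 Wu u0).
rewrite (_ : dirichlet _ _ = 0%E).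
  by rewrite poweR0r// mule0 lee_fin normr_le0 => /eqP.
rewrite /dirichlet integral0_eq// => x _.
by rewrite enorm_sqr big1// => i _; rewrite mxE expr0n.
Qed.

End linear_forms.

Unset Implicit Arguments.

Theorem theoremB (R : realType) (p : R) (hp : 1 < p) :
  exists beta : R, 2 < beta /\
  (forall (N : nat) (Omega : set 'rV[R]_N) (f : 'rV[R]_N -> R)
      (r : \bar R) (alpha : R),
    (3 <= N)%N ->
    open Omega ->
    lebesgue_rV N Omega = +oo%E ->
    ((N%:R / 2)%:E < r)%E ->
    measurable_fun Omega f ->
    ('N[lebesgue_rV N]_r [ (fun x => (f x)%:E) \_ Omega ] < +oo)%E ->
    1 + N%:R / 2 < alpha ->
    (exists C rho : R, {ae lebesgue_rV N, forall x, Omega x ->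
       rho <= enorm x -> `|f x| <= C * enorm x `^ (- alpha)}) ->
    energy_stability p beta Omega (pairing Omega f)) /\
  (forall (N : nat) (Omega : set 'rV[R]_N) (L : ('rV[R]_N -> R) -> R),
    (0 < N)%N ->
    open Omega ->
    (lebesgue_rV N Omega < +oo)%E ->
    dual_W012 Omega L ->
    energy_stability p beta Omega L).
Proof.
exists (2 * p); split; first by lra.
split=> [N Omega f r alpha _ oO _ _ mf _ _ _|N Omega L _ oO _ dL].
- apply: energy_stability_linear => //; first exact: open_measurable_rV.
  apply: pairing_linear_off_kernel => //; exact: open_measurable_rV.
- apply: energy_stability_linear => //; first exact: open_measurable_rV.
  apply: dual_linear_off_kernel => //; exact: open_measurable_rV.
Qed.
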